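(* Let $G$ be an undirected tree on $[p]$ and let $I=\{i_1,\dots,i_K\}$ be a set of pairwise distinct leaves of $G$, corresponding to the sequence of intervention targets $\mathcal{I}=(\emptyset,\{i_1\},\dots,\{i_K\})$. Then the polytope $\mathrm{CIM}_G^{\mathcal{I}}$ has an H-representation consisting of (i) the star inequalities, (ii) the bidirected-edge inequalities, and (iii) the forked-tree inequalities, all as defined below.
   Context: Characteristic imsets: for a DAG $\mathcal{D}$ on a finite node set $V$ and $A\subseteq V$, $c_{\mathcal{D}}(A)=1$ if there exists $a\in A$ such that every $b\in A\setminus\{a\}$ is a parent of $a$ in $\mathcal{D}$, and $c_{\mathcal{D}}(A)=0$ otherwise. For a DAG $\mathcal{G}$ on $[p]$, $\mathcal{G}^{\mathcal{I}}$ is the DAG obtained by adding, for each $i\in I$, a new node $i'$ and the edge $i'\to i$. Let $G^I$ be the graph $G$ together with the edges $i'\to i$, $i\in I$. Then $\mathrm{CIM}_G^{\mathcal{I}}=\mathrm{conv}\{c_{\mathcal{G}^{\mathcal{I}}}:\mathcal{G}\text{ a DAG on }[p]\text{ with skeleton }G\}$. It is regarded as a polytope in the coordinates $x_A$, where $A$ ranges over vertex sets of star subgraphs of $G^I$ (a vertex together with at least two of its neighbours), i.e. sets with $|A|\ge 3$; all other coordinates are constant on the polytope. $N_G(v)$ denotes the neighbours of $v$ and $N_G[v]=N_G(v)\cup\{v\}$. (i) Star inequalities: for every non-leaf node $\ell$ of $G$ and every set $V'$ with $\ell\in V'\subseteq N_G[\ell]$ and $|V'|\ge 3$: $\sum_{V'\subseteq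 A\subseteq N_G[\ell]}(-1)^{|A\setminus V'|}x_A\ge 0$. (ii) Bidirected-edge inequalities: for an edge $u-v$ of $G$ define $\mathbb{1}_{v\leftarrow u}(x)=\sum_{\emptyset\ne A\subseteq N_G(v)\setminus\{u\}}(-1)^{|A|+1}x_{A\cup\{u,v\}}$ if $v\notin I$, and $\mathbb{1}_{v\leftarrow u}(x)=x_{uvv'}$ if $v\in I$. For every edge $u-v$ of $G$ such that neither $u$ nor $v$ is a leaf of $G^I$ (an internal edge of $G^I$), the inequality is $\mathbb{1}_{v\leftarrow u}(x)+\mathbb{1}_{u\leftarrow v}(x)\le 1$. (iii) Forked-tree inequalities: for a node $c$ of $G$ and a set $L\subseteq N_G(c)$, define $\mathbb{1}^{N_G[c]}_{c\to L}(x)=\sum_{c\in A\subseteq N_G[c]\setminus L,\ |A|\ge 3}\ \sum_{B\subseteq L}(-1)^{|A\cup B|-1}(|A|-2)x_{A\cup B}$. For a subtree $T'$ of $G$ and a node $c$ of $T'$ define $\#^{N_{T'}[c]}(x)=\sum_{c\in A\subseteq N_{T'}[c],\ |A|\ge 3}(-1)^{|A|-1}x_A$. A subtree $T'$ of $G$ containing no leaves of $G^I$ is forked if: (1) each leaf $u$ of $T'$ with $u\notin I$ satisfies $\deg_G(u)-\deg_{T'}(u)\ge 2$; (2) for each $u\in I$, if $N_G[u]\cap V(T')\neq\emptyset$ then $u\in V(T')$; (3) $I\cap V(T')$ consists only of leaf nodes of $T'$. For a forked subtree $T'$, let $L(T')$ be the set of leaf edges $(c,d)$ of $T'$ with leaf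 node $c\in I$ and $d$ its neighbour, let $\mathrm{int}(T')$ be the set of non-leaf nodes of $T'$, and $F(T')=\{u\in V(T'):\deg_G(u)-\deg_{T'}(u)\ge 2\}$. The forked-tree inequality of $T'$ is $\sum_{c\in F(T')}\mathbb{1}^{N_G[c]}_{c\to N_{T'}(c)}(x)+\sum_{(c,d)\in L(T')}(1-x_{cc'd})\le 1+\sum_{c\in\mathrm{int}(T')}\#^{N_{T'}[c]}(x)$.
   Formalization: Star inequalities are taken at non-leaf nodes of G^I with neighbourhoods in G^I, which adds x_{ii'j} ≥ 0 for each target i with neighbour j (needed for the path 1-2-3, I={1}); the case p=2, |I|=1, where no listed inequality gives x_{ii'j} ≤ 1, is excluded. *)

(* Defs.v *)
From mathcomp Require Import all_boot all_order all_algebra.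
From mathcomp Require Import reals.

Set Implicit Arguments.
Unset Strict Implicit.
Unset Printing Implicit Defensive.

Import Order.TTheory GRing.Theory Num.Theory.
Local Open Scope ring_scope.

Section Graphs.
Variable T : finType.
Implicit Types (g d : rel T) (U A B : {set T}).

Definition nbr g v : {set T} := [set w | g v w].
Definition cnbr g v : {set T} := v |: nbr g v.
Definition deg g v : nat := #|nbr g v|.
Definition leaf g v : bool := deg g v == 1%N.

(* [tree U g]: the graph with vertex set U and edge relation g is a tree. *)
Definition tree U g : Prop :=
  [/\ symmetric g, irreflexive g & forall v w, g v w -> (v \in U) && (w \in U)]
  /\ [/\ U != set0,
         {in U &, forall v w, connect g v w}
       & forall c : seq T, cycle g c -> uniq c -> (size c <= 2)%N].

Definition acyclic d : Prop := forall c : seq T, cycle d c -> c = [::].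
Definition skeleton d : rel T := fun v w => d v w || d w v.

Definition cimset d A : bool :=
  [exists a in A, [forall b in A :\ a, d b a]].

Definition is_star g A : bool :=
  [exists v in A, (A :\ v \subset nbr g v) && (2 <= #|A :\ v|)%N].

End Graphs.

Notation star_set g := {A : {set _} | is_star g A}.

Definition conv_hull (R : numDomainType) (M : lmodType R) (S : M -> Prop)
    (x : M) : Prop :=
  exists n (w : 'I_n -> R) (y : 'I_n -> M),
    [/\ forall k, 0 <= w k, \sum_k w k = 1, forall k, S (y k)
      & x = \sum_k w k *: y k].

Section Interventions.
Variables (p : nat) (I : {set 'I_p}).

(* [inl v] is the node v of [p]; [inr i] is the new node i' attached to i. *)
Definition node : finType := ('I_p + {i : 'I_p | i \in I})%type.

Definition add_targets (d : rel 'I_p) : rel node := fun v w =>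
  match v, w with
  | inl a, inl b => d a b
  | inr i, inl b => val i == b
  | _, _ => false
  end.

Definition graphI (e : rel 'I_p) : rel node := skeleton (add_targets e).

(* {v'} if v \in I, and the empty set otherwise *)
Definition primed (v : 'I_p) : {set node} :=
  [set w : node | if w is inr i then val i == v else false].

Definition emb (A : {set 'I_p}) : {set node} := [set inl a | a in A].

End Interventions.

Arguments add_targets {p} I d.
Arguments graphI {p} I e.
Arguments emb {p} I A.
Arguments primed {p} I v.

Notation cim_space R e I := {ffun star_set (graphI I e) -> R^o}.

Section Polytope.
Variables (R : realType) (p : nat) (e : rel 'I_p) (I : {set 'I_p}).

Local Notation gI := (graphI I e).

Definition cim_point (d : rel 'I_p) : cim_space R e I :=
  [ffun A : star_set gI => (cimset (add_targets I d) (val A))%:R].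

Definition CIM : cim_space R e I -> Prop :=
  conv_hull (fun y => exists d : rel 'I_p,
    [/\ acyclic d, skeleton d =2 e & y = cim_point d]).

(* The coordinate x_A; the default value is never used below, where A is
   always the vertex set of a star of the graph. *)
Definition star_coord (x : cim_space R e I) (A : {set node I}) : R :=
  if insub A is Some s then x s else 0.

Definition coordG (x : cim_space R e I) (A : {set 'I_p}) : R := star_coord x (emb I A).

(* x_{v v' u}, for v in I *)
Definition coord_target (x : cim_space R e I) (v u : 'I_p) : R :=
  star_coord x (emb I [set v; u] :|: primed I v).

(* The centre l ranges over the non-leaf nodes of G^I, with closed
   neighbourhoods in G^I. These are the non-leaf nodes of G, whose
   neighbourhoods are the same in both graphs, together with the targets:
   a target i with neighbour j contributes x_{i i' j} >= 0, a facet that the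
   other families do not imply (path 1 - 2 - 3, I = {1}: without it the
   point x_{123} = 0, x_{1 1' 2} = -1 satisfies every inequality). *)
Definition star_ineqs (x : cim_space R e I) : Prop :=
  forall (l : node I) (V' : {set node I}),
    ~~ leaf gI l -> l \in V' -> V' \subset cnbr gI l -> (3 <= #|V'|)%N ->
    0 <= \sum_(A : {set node I} | (V' \subset A) && (A \subset cnbr gI l))
           (-1) ^+ #|A :\: V'| * star_coord x A.

Definition arrow (x : cim_space R e I) (v u : 'I_p) : R :=
  if v \in I then coord_target x v u
  else \sum_(A : {set 'I_p} | (A != set0) && (A \subset nbr e v :\ u))
         (-1) ^+ #|A|.+1 * coordG x (A :|: [set u; v]).

Definition bidirected_ineqs (x : cim_space R e I) : Prop :=
  forall u v : 'I_p, e u v -> ~~ leaf gI (inl u) -> ~~ leaf gI (inl v) ->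
    arrow x v u + arrow x u v <= 1.

Definition out_ind (x : cim_space R e I) (c : 'I_p) (L : {set 'I_p}) : R :=
  \sum_(A : {set 'I_p} |
        [&& c \in A, A \subset cnbr e c :\: L & (3 <= #|A|)%N])
    \sum_(B : {set 'I_p} | B \subset L)
      (-1) ^+ (#|A :|: B| - 1) * (#|A| - 2)%:R * coordG x (A :|: B).

(* (U, f) is the subtree T', with vertex set U and edge relation f. *)
Definition sharp (f : rel 'I_p) (x : cim_space R e I) (c : 'I_p) : R :=
  \sum_(A : {set 'I_p} | [&& c \in A, A \subset cnbr f c & (3 <= #|A|)%N])
    (-1) ^+ (#|A| - 1) * coordG x A.

Definition subtree (U : {set 'I_p}) (f : rel 'I_p) : Prop :=
  tree U f /\ subrel f e.

Definition forked (U : {set 'I_p}) (f : rel 'I_p) : Prop :=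
  [/\ forall u, u \in U -> ~~ leaf gI (inl u),
      forall u, u \in U -> leaf f u -> u \notin I ->
        (2 <= deg e u - deg f u)%N,
      forall u, u \in I -> cnbr e u :&: U != set0 -> u \in U
    & forall u, u \in I :&: U -> leaf f u].

Definition fork_nodes (U : {set 'I_p}) (f : rel 'I_p) : {set 'I_p} :=
  [set u in U | (2 <= deg e u - deg f u)%N].

Definition target_leaf_edges (f : rel 'I_p) : {set 'I_p * 'I_p} :=
  [set cd | [&& f cd.1 cd.2, leaf f cd.1 & cd.1 \in I]].

Definition inner_nodes (U : {set 'I_p}) (f : rel 'I_p) : {set 'I_p} :=
  [set u in U | ~~ leaf f u].

Definition forked_tree_ineqs (x : cim_space R e I) : Prop :=
  forall (U : {set 'I_p}) (f : rel 'I_p), subtree U f -> forked U f ->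
    \sum_(c in fork_nodes U f) out_ind x c (nbr f c)
      + \sum_(cd in target_leaf_edges f) (1 - coord_target x cd.1 cd.2)
    <= 1 + \sum_(c in inner_nodes U f) sharp f x c.

End Polytope.

(* Main.v *)
(** Stars of a tree have a unique centre. For a centre v the coordinates x_A are
    therefore the probabilities that a given set of at least two neighbours
    consists of parents of v, and Möbius inversion turns them into the
    probabilities that the parent set of v is S, |S| >= 2; the star inequalities
    say that these are nonnegative. A family of local parent-set distributions
    that agree on the direction of every edge glues, along the tree, to a
    distribution on orientations. So x lies in the polytope iff one can choose
    the missing probabilities tau v u that u is the only parent of v: for each
    edge u - v a fixed amount, nonnegative by the bidirected-edge inequality,
    has to be split between tau v u and tau u v, and each vertex has a bounded
    capacity. By Hakimi's theorem this is possible iff no vertex set W contains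
    more edge weight than capacity. It suffices to check connected W, and
    completing W with its adjacent targets and pruning its leaves of degree two
    in G reduces the condition to the forked-tree inequalities. *)
Require Import Defs.
From mathcomp Require Import all_boot all_order all_algebra.
From mathcomp Require Import reals.
From mathcomp Require Import ring lra zify.

Set Implicit Arguments.
Unset Strict Implicit.
Unset Printing Implicit Defensive.

Import Order.TTheory GRing.Theory Num.Theory.

(** * Alternating sums over intervals of sets *)

Section AlternatingSums.
Local Open Scope ring_scope.
Variables (R : comPzRingType) (T : finType).
Implicit Types (A B X Y : {set T}).

(** The sum is the expansion of a product with one factor [F i + G i] per element. Such a factor
    vanishes exactly where [A] and [B] differ; if they agree it is -1 on [A] and 1 elsewhere. *)
Lemma sum_sign_interval A B :
  \sum_(X : {set T} | (A \subset X) && (X \subset B)) (-1) ^+ #|X|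
    = (-1) ^+ #|A| *+ (A == B) :> R.
Proof.
pose F (i : T) : R := - (i \in B)%:R.
pose G (i : T) : R := (i \notin A)%:R.
have FG (X : {set T}) :
    \prod_i (if i \in X then F i else G i)
      = (-1) ^+ #|X| *+ ((A \subset X) && (X \subset B)).
  case: (boolP (A \subset X)) => [sAX|]; last first.
    move=> /subsetPn[i iA iX]; rewrite (bigD1 i) //= (negPf iX) /G iA /=.
    by rewrite mul0r.
  case: (boolP (X \subset B)) => [sXB|]; last first.
    by move=> /subsetPn[i iX iB]; rewrite (bigD1 i) //= iX /F (negPf iB) oppr0 mul0r.
  rewrite /= mulr1n -prodr_const [RHS]big_mkcond; apply: eq_bigr => i _.
  case: ifP => [iX|/negbT iX]; first by rewrite /F (subsetP sXB).
  by rewrite /G (contra (subsetP sAX i)).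
rewrite big_mkcond.
transitivity (\prod_i (F i + G i)).
  rewrite bigA_distr; apply: eq_big => // X _.
  by rewrite FG; case: ifP.
case: eqVneq => [AB|neqAB] /=.
  rewrite -prodr_const [RHS]big_mkcond; apply: eq_bigr => i _.
  by rewrite /F /G -AB; case: (i \in A); rewrite ?addr0 ?oppr0 ?add0r.
have /existsP[i Hi] : [exists i, (i \in A) != (i \in B)].
  rewrite -negb_forall; apply: contra neqAB => /forallP H.
  by apply/eqP/setP => i; apply/eqP.
rewrite (bigD1 i) //= /F /G.
by move: Hi; case: (i \in A); case: (i \in B); rewrite //= ?addNr ?addr0 ?oppr0 mul0r.
Qed.

Lemma sum_sign_subset Y :
  \sum_(X : {set T} | X \subset Y) (-1) ^+ #|X| = (Y == set0)%:R :> R.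
Proof.
have := sum_sign_interval set0 Y; rewrite cards0 expr0 eq_sym => <-.
by apply: eq_bigl => X; rewrite sub0set.
Qed.

Lemma sum_signD_interval A B :
  \sum_(X : {set T} | (A \subset X) && (X \subset B)) (-1) ^+ #|X :\: A|
    = (A == B)%:R :> R.
Proof.
transitivity ((-1) ^+ #|A| * ((-1) ^+ #|A| *+ (A == B)) : R); last first.
  by rewrite mulrnAr -exprMn mulrNN mulr1 expr1n.
rewrite -sum_sign_interval mulr_sumr; apply: eq_bigr => X /andP[sAX _].
rewrite cardsD (setIidPr sAX) -signr_odd oddB ?subset_leq_card //.
by rewrite signr_addb !signr_odd mulrC.
Qed.

Lemma sum_signB_interval A B :
  \sum_(X : {set T} | (A \subset X) && (X \subset B)) (-1) ^+ #|B :\: X|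
    = (A == B)%:R :> R.
Proof.
transitivity ((-1) ^+ #|B| * ((-1) ^+ #|A| *+ (A == B)) : R); last first.
  case: eqVneq => [->|]; last by rewrite mulr0.
  by rewrite mulrnAr -exprMn mulrNN mulr1 expr1n.
rewrite -sum_sign_interval mulr_sumr; apply: eq_bigr => X /andP[_ sXB].
rewrite cardsD (setIidPr sXB) -signr_odd oddB ?subset_leq_card //.
by rewrite signr_addb !signr_odd.
Qed.

(** Double counting of pairs of a set [X] and an element [i] of it; for fixed [i] the sets form the
    interval from [[set i]] to [Y]. *)
Lemma sum_sign_card Y :
  \sum_(X : {set T} | X \subset Y) (-1) ^+ #|X| * #|X|%:R
    = - (#|Y| == 1)%:R :> R.
Proof.
transitivity (\sum_(X : {set T} | X \subset Y) \sum_(i in Y | i \in X)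
    (-1) ^+ #|X| : R).
  apply: eq_bigr => X sXY; rewrite sumr_const mulr_natr; congr (_ *+ _).
  apply: eq_card => i; rewrite [RHS]unfold_in /=.
  by case: (boolP (i \in X)) => [/(subsetP sXY)->|]; rewrite ?andbF.
rewrite (exchange_big_dep (mem Y)) /=; last by move=> X i _ /andP[].
transitivity (\sum_(i in Y) ((-1) ^+ #|[set i]| *+ ([set i] == Y)) : R).
  apply: eq_bigr => i iY; rewrite -sum_sign_interval; apply: eq_bigl => X.
  by rewrite sub1set iY andTb andbC.
case: (boolP (#|Y| == 1)) => [/cards1P[i ->]|Y1].
  by rewrite big_set1 eqxx cards1 expr1.
rewrite oppr0 big1 // => i _; case: eqVneq => // E.
by move: Y1; rewrite -E cards1.
Qed.

(** The empty set and the singletons are taken out of the full alternating sum. With [Y] the parents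
    inside a subtree, this is the coefficient of a parent set in [sharp]. *)
Lemma sum_sign_card_ge2 Y :
  \sum_(X : {set T} | (X \subset Y) && (2 <= #|X|)%N) (-1) ^+ #|X|
    = (Y == set0)%:R - 1 + #|Y|%:R :> R.
Proof.
rewrite -sum_sign_subset [in RHS](bigID (fun X => (2 <= #|X|)%N)) /=.
suff -> : \sum_(X : {set T} | (X \subset Y) && ~~ (2 <= #|X|)%N) (-1) ^+ #|X|
    = 1 - #|Y|%:R :> R by ring.
rewrite (bigD1 set0) /=; last by rewrite sub0set cards0.
rewrite cards0 expr0; congr (_ + _).
rewrite -sumr_const -sumrN.
transitivity (\sum_(X in [set [set i] | i in Y]) (-1) ^+ #|X| : R).
  apply: eq_bigl => X; apply/idP/imsetP => [/andP[/andP[sXY X2] X0]|[i iY ->]].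
    have /cards1P[i Xi] : #|X| == 1%N by rewrite eqn_leq card_gt0 X0 andbT -ltnS ltnNge.
    by exists i => //; rewrite -sub1set -Xi.
  by rewrite sub1set iY cards1 /= -cards_eq0 cards1.
rewrite big_imset /=; last by move=> i j _ _ /set1_inj.
by apply: eq_bigr => i _; rewrite cards1.
Qed.

(** This turns the weights of [out_ind] into the indicator of having at least two parents. *)
Lemma sum_sign_predcard_ge2 Y :
  \sum_(X : {set T} | (X \subset Y) && (2 <= #|X|)%N) (-1) ^+ #|X| * (#|X| - 1)%:R
    = (2 <= #|Y|)%N%:R :> R.
Proof.
(* The subtraction is now that of the ring, so the empty set contributes -1, and singletons
   contribute 0. *)
have key : \sum_(X : {set T} | (X \subset Y)) (-1) ^+ #|X| * (#|X|%:R - 1)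
    = - (#|Y| == 1)%:R - (Y == set0)%:R :> R.
  under eq_bigr do rewrite mulrBr mulr1.
  by rewrite sumrB sum_sign_card sum_sign_subset.
have -> : (2 <= #|Y|)%N%:R = 1 - (#|Y| == 1)%:R - (Y == set0)%:R :> R.
  by rewrite -cards_eq0; case: #|Y| => [|[|k]] /=; ring.
move: key; rewrite (bigID (fun X => (2 <= #|X|)%N)) /=.
rewrite [X in _ + X = _ -> _](bigD1 set0) /=; last by rewrite sub0set cards0.
rewrite [X in _ + (_ + X) = _ -> _]big1; last first.
  move=> X /andP[/andP[_ X2] X0].
  have -> : #|X| = 1%N.
    by apply/eqP; rewrite eqn_leq card_gt0 X0 andbT -ltnS ltnNge.
  by rewrite subrr mulr0.
rewrite cards0 expr0 mul1r sub0r addr0 => /eqP; rewrite subr_eq => /eqP key.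
rewrite -addrA addrC -key; apply: eq_bigr => X /andP[_ X2].
by rewrite natrB // (leq_trans _ X2).
Qed.

End AlternatingSums.

(** * Splitting edge weights under vertex capacities *)

Section Splitting.
Local Open Scope ring_scope.
Variables (R : realFieldType) (V : finType).
Implicit Types (m : V -> R) (b t : V * V -> R) (W : {set V}).

Definition inside W (z : V * V) : bool := (z.1 \in W) && (z.2 \in W).

(** The room left in [W] once the weight of all pairs inside it has been assigned; its nonnegativity
    for every [W] is Hakimi's condition. *)
Definition slack m b W : R :=
  \sum_(v in W) m v - \sum_(z : V * V | inside W z) b z.

(** Capacity is modular. Weight is supermodular: a pair inside [A] or [B] is inside the union, and a
    pair inside both is inside the intersection too. *)
Lemma slack_submodular m b A B : (forall z, 0 <= b z) ->
  slack m b (A :|: B) + slack m b (A :&: B) <= slack m b A + slack m b B.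
Proof.
move=> b0; rewrite /slack.
have Em : \sum_(v in A :|: B) m v + \sum_(v in A :&: B) m v
    = \sum_(v in A) m v + \sum_(v in B) m v.
  rewrite !(big_mkcond (fun v => v \in _)) /= -!big_split /=.
  by apply: eq_bigr => v _; rewrite !inE; case: (v \in A); case: (v \in B) => /=; ring.
have : \sum_(z | inside A z) b z + \sum_(z | inside B z) b z
    <= \sum_(z | inside (A :|: B) z) b z + \sum_(z | inside (A :&: B) z) b z.
  rewrite !(big_mkcond (inside _)) /= -!big_split /=.
  apply: ler_sum => z _; rewrite /inside !inE; have := b0 z.
  by case: (z.1 \in A); case: (z.2 \in A); case: (z.1 \in B); case: (z.2 \in B) => /=; lra.
by lra.
Qed.

Let upd (T : eqType) (z0 : T) (c : R) (f : T -> R) z := f z + (z == z0)%:R * c.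

Lemma sum_upd (T : finType) (P : pred T) (z0 : T) (c : R) (f : T -> R) :
  \sum_(z | P z) upd z0 c f z = \sum_(z | P z) f z + (P z0)%:R * c.
Proof.
rewrite /upd big_split /=; congr (_ + _).
rewrite (big_mkcond P) /= (bigD1 z0) //= eqxx mul1r big1 ?addr0.
  by case: (P z0); rewrite ?mul1r ?mul0r.
by move=> z /negPf->; rewrite mul0r; case: (P z).
Qed.

(* Fractional version of Hakimi's orientation theorem. One pair (a, c) is
   treated at a time: a takes as much of b (a, c) as the constraints allow,
   and if a tight set stops it then submodularity leaves room for the rest
   at c. *)
Theorem fractional_split m b :
  (forall z, 0 <= b z) -> (forall v, b (v, v) = 0) ->
  (forall W, 0 <= slack m b W) ->
  exists t, (forall z, 0 <= t z <= b z) /\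
    forall v, \sum_(z | z.1 == v) t z + \sum_(z | z.2 == v) (b z - t z) <= m v.
Proof.
(* Induction on the number of pairs of nonzero weight. *)
have [k] := ubnP #|[set z | b z != 0]|.
elim: k => // k IH in m b *; rewrite ltnS => bk b0 bvv slack0.
case: (pickP (fun z => b z != 0)) => [z0 z0P|bE]; last first.
  have {}bE z : b z = 0 by have /eqP := bE z.
  exists (fun=> 0); split=> [z|v]; first by rewrite bE lexx.
  rewrite big1 // add0r big1; last by move=> z _; rewrite bE subr0.
  have := slack0 [set v]; rewrite /slack big_set1 big1 => [|z _]; last exact: bE.
  by rewrite subr0.
case: z0 z0P => a c z0.
have neq_ac : a != c by apply: contra z0 => /eqP->; rewrite bvv.
pose b' := upd (a, c) (- b (a, c)) b.
have b'0 z : 0 <= b' z.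
  rewrite /b' /upd; case: eqP => [->|_]; first by rewrite mul1r subrr.
  by rewrite mul0r addr0.
have F0 W : (inside W (a, c))%:R * b (a, c) <= slack m b' W.
  have := slack0 W; rewrite /slack /b' (@sum_upd _ (inside W)); lra.
have F0' W : 0 <= slack m b' W.
  by apply: le_trans (F0 W); rewrite mulr_ge0 ?ler0n.
have [t0 /andP[t0ge t0le] t0P] : exists2 t0, 0 <= t0 <= b (a, c) & forall W,
    (a \in W)%:R * t0 + (c \in W)%:R * (b (a, c) - t0) <= slack m b' W.
  (* These are the sets that prevent [a] from taking all of [b (a, c)]; if there are any, their
     least slack is the share [t0] of [a]. *)
  pose P W := [&& a \in W, c \notin W & slack m b' W < b (a, c)].
  case: (pickP P) => [W1 PW1|noP]; last first.
    exists (b (a, c)); first by rewrite lexx b0.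
    move=> W; rewrite subrr mulr0 addr0.
    have := noP W; have := F0 W; have := F0' W; rewrite /P /inside /=.
    by case: (a \in W); case: (c \in W) => //=; rewrite ?mul1r ?mul0r // => _ _ /negbT; rewrite -leNgt.
  case: (arg_minP (slack m b') PW1) => W0 /and3P[aW0 cW0 W0lt] W0min.
  exists (slack m b' W0); first by rewrite F0' ltW.
  move=> W; case: (boolP (a \in W)) => aW; case: (boolP (c \in W)) => cW;
    rewrite ?mul0r ?mul1r ?addr0 ?add0r.
  - by have := F0 W; rewrite /inside /= aW cW mul1r; lra.
  - case: (ltP (slack m b' W) (b (a, c))) => [lt|ge].
      by apply: W0min; rewrite /P aW cW.
    exact: le_trans (ltW W0lt) ge.
  (* The union of [W] and [W0] contains both ends and so has slack at least [b (a, c)], while the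
     intersection has nonnegative slack. Hence [W] has room for what the tight set [W0] refuses. *)
  - have := slack_submodular m W W0 b'0; have := F0 (W :|: W0).
    have := F0' (W :&: W0); rewrite /inside /= !inE cW aW0 orbT mul1r.
    lra.
  - exact: F0'.
pose m' := upd c (t0 - b (a, c)) (upd a (- t0) m).
have card' : (#|[set z | b' z != 0%R]| < k)%N.
  apply: leq_trans bk; apply: proper_card; apply/properP.
  split; last by exists (a, c); rewrite !inE // /b' /upd eqxx mul1r subrr eqxx.
  apply/subsetP => z; rewrite !inE /b' /upd; case: (z =P (a, c)) => [-> _ //|_].
  by rewrite mul0r addr0.
have b'vv v : b' (v, v) = 0.
  rewrite /b' /upd bvv xpair_eqE; case: eqP => [->|]; last by rewrite mul0r addr0.
  by rewrite (negPf neq_ac) mul0r addr0.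
have slack' W : 0 <= slack m' b' W.
  have := t0P W; rewrite {2}/slack (@sum_upd _ (mem W)) (@sum_upd _ (mem W)) /=.
  rewrite /slack; lra.
have [t [tb tm]] := IH m' b' card' b'0 b'vv slack'.
have tE z : t z <= b z.
  have /andP[_] := tb z; rewrite /b' /upd; case: eqP => [->|_]; last by rewrite mul0r addr0.
  by rewrite mul1r; have := b0 (a, c); lra.
(* Since [b'] vanishes at this pair, adding [t0] there makes the share exactly [t0]. *)
have tac : t (a, c) = 0.
  by apply/eqP; rewrite eq_le; have := tb (a, c); rewrite /b' /upd eqxx mul1r subrr andbC.
exists (upd (a, c) t0 t); split=> [z|v].
  have /andP[tz _] := tb z; have := tE z; rewrite /upd; case: eqP => [->|_] /=.
    by rewrite tac; lra.
  by rewrite mul0r addr0 => ->; rewrite tz.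
have := tm v; rewrite (@sum_upd _ (fun z => z.1 == v)) !sumrB.
rewrite (@sum_upd _ (fun z => z.2 == v)) /b' (@sum_upd _ (fun z => z.2 == v)) /=.
rewrite /m' /upd [a == v]eq_sym [c == v]eq_sym.
lra.
Qed.

End Splitting.

(** * Trees *)

Section Trees.
Variable T : finType.
Implicit Types (g f d : rel T) (U A B : {set T}).

Definition induced g A : rel T := fun v w => [&& v \in A, w \in A & g v w].

Lemma induced_sym g A : symmetric g -> symmetric (induced g A).
Proof. by move=> gs v w; rewrite /induced gs; case: (v \in A); case: (w \in A). Qed.

Lemma sub_induced g A B : A \subset B -> subrel (induced g A) (induced g B).
Proof. by move=> /subsetP AB v w /and3P[/AB vB /AB wB vw]; apply/and3P. Qed.

Lemma sub_connect g d : subrel g d -> subrel (connect g) (connect d).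
Proof. by move=> gd; apply: connect_sub => v w /gd; apply: connect1. Qed.

Lemma nbr_induced g A v : v \in A -> nbr (induced g A) v = nbr g v :&: A.
Proof. by move=> vA; apply/setP => w; rewrite !inE /induced vA /= andbC. Qed.

Lemma connect_crossing g A v w : connect g v w -> v \in A -> w \notin A ->
  exists a b, [/\ a \in A, b \notin A & g a b].
Proof.
case/connectP => s; elim: s v => [|z s IH] v /= => [_ -> ->//|/andP[vz zs] ws vA wA].
by case: (boolP (z \in A)) => zA; [apply: IH zs ws zA wA | exists v, z].
Qed.

(** Otherwise a simple path inside [A] from [w] to [w'], closed up through [u], would be a cycle of
    length at least three. *)
Lemma unique_attachment g A u w w' : symmetric g ->
  (forall c, cycle g c -> uniq c -> (size c <= 2)%N) ->
  connect (induced g A) w w' -> u \notin A -> w \in A ->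
  g u w -> g u w' -> w' = w.
Proof.
move=> gs acyc /connectP[s0 ws0 def_w'] uA wA uw.
case/shortenP: ws0 def_w' => s ws s_uniq _ ->.
case: s ws s_uniq => // z s ws s_uniq uw'.
have sA : {subset w :: z :: s <= A}.
  have sub t : forall x, x \in A -> path (induced g A) x t -> {subset x :: t <= A}.
    elim: t => [|y t IH] x xA; first by move=> _ v; rewrite inE => /eqP->.
    case/andP=> /and3P[_ yA _] yt v; rewrite inE => /orP[/eqP->//|].
    exact: IH yA yt v.
  exact: sub wA ws.
have := acyc (u :: w :: z :: s); rewrite cons_uniq s_uniq andbT.
have -> : u \notin w :: z :: s by apply: contra uA => /sA.
have gs' : subrel (induced g A) g by move=> x y /and3P[].
have ws' := sub_path gs' ws.
suff -> : cycle g [:: u, w, z & s] by move=> /(_ isT isT).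
by rewrite (cycle_path u) /= in uw' *; rewrite gs uw' uw.
Qed.

(** Induction principle: a tree grows from a single vertex by attaching one leaf at a time. An edge
    crossing out of the connected part provides the next leaf, and acyclicity makes its neighbour in
    that part unique. *)
Lemma tree_growth U f (P : {set T} -> Prop) : tree U f ->
  (forall v, v \in U -> P [set v]) ->
  (forall A u w, A \subset U -> u \in U -> u \notin A -> w \in A -> f u w ->
    (forall w', w' \in A -> f u w' -> w' = w) -> P A -> P (u |: A)) ->
  P U.
Proof.
case=> -[fs fi fU] [/set0Pn[r rU] fcon acyc] P1 PS.
suff grow n A : #|U :\: A| = n -> A \subset U -> r \in A ->
    (forall v, v \in A -> connect (induced f A) r v) -> P A -> P U.
  apply: (grow _ [set r] erefl); rewrite ?sub1set ?set11 //.
    by move=> v /set1P->; apply: connect0.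
  exact: P1.
elim: n A => [|n IH] A cardA AU rA conA PA.
  suff -> : U = A by [].
  by apply/eqP; rewrite eqEsubset AU andbT -setD_eq0 -cards_eq0 cardA.
have /card_gt0P[u' /setDP[u'U u'A]] : 0 < #|U :\: A| by rewrite cardA.
have [w [u [wA uA wu]]] := connect_crossing (fcon r u' rU u'U) rA u'A.
have uU : u \in U by have /andP[] := fU _ _ wu.
have symA := sym_connect_sym (induced_sym A fs).
apply: (IH (u |: A)).
- have -> : U :\: (u |: A) = (U :\: A) :\ u by rewrite setDDl setUC.
  by apply/eqP; rewrite -eqSS -cardA (cardsD1 u (U :\: A)) inE uA uU.
- by rewrite subUset sub1set uU.
- by rewrite inE rA orbT.
- have mono := sub_connect (@sub_induced f A (u |: A) (subsetUr _ _)).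
  move=> v /setU1P[->|vA]; last exact/mono/conA.
  apply: connect_trans (mono _ _ (conA _ wA)) (connect1 _).
  by rewrite /induced !inE wA wu eqxx orbT.
apply: (PS _ _ w) => //; first by rewrite fs.
move=> w' w'A uw'.
apply: (unique_attachment fs acyc _ uA wA _ uw'); last by rewrite fs.
by apply: connect_trans (conA _ w'A); rewrite symA conA.
Qed.

(** A tree has one edge less than vertices, and every edge counts twice in the degree sum. *)
Lemma tree_sum_deg U f : tree U f -> \sum_(v in U) deg f v + 2 = 2 * #|U|.
Proof.
move=> treeU; have [[fs fi fU] _] := treeU.
(* Degrees are counted inside [A], so attaching [u] adds 1 at [u] and 1 at its neighbour [w]. *)
pose P A := \sum_(v in A) #|nbr f v :&: A| + 2 = 2 * #|A|.
have <- : \sum_(v in U) #|nbr f v :&: U| = \sum_(v in U) deg f v.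
  apply: eq_bigr => v vU; rewrite /deg (setIidPl _) //.
  by apply/subsetP => w; rewrite inE => /fU/andP[].
apply: (@tree_growth U f P) => // [v _|A u w AU uU uA wA uw uniqw PA]; rewrite /P.
  rewrite big_set1 cards1; suff -> : nbr f v :&: [set v] = set0 by rewrite cards0.
  by apply/setP => w; rewrite !inE; case: eqVneq => [->|]; rewrite ?fi ?andbF.
rewrite big_setU1 //= cardsU1 uA mulnDr -PA.
have -> : nbr f u :&: (u |: A) = [set w].
  apply/setP => z; rewrite !inE; case: (eqVneq z w) => [->|zw].
    by rewrite uw wA orbT.
  case: (eqVneq z u) => [->|zu] /=; first by rewrite fi.
  by apply/negP => /andP[uz zA]; rewrite (uniqw z zA uz) eqxx in zw.
rewrite cards1 [X in _ + X + _](_ : _ = \sum_(v in A) (#|nbr f v :&: A| + (v == w))).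
  rewrite big_split /=.
  have -> : \sum_(v in A) (v == w) = 1.
    by rewrite (bigD1 w) //= eqxx big1 // => v /andP[_ /negPf->].
  lia.
apply: eq_bigr => v vA; rewrite (cardsD1 u) addnC; congr (_ + _).
  apply: eq_card => z; rewrite !inE; case: (eqVneq z u) => [->|] //=.
  by rewrite (negPf uA) andbF.
rewrite !inE eqxx andbT; congr (nat_of_bool _); rewrite fs.
by apply/idP/eqP => [uv|->//]; apply: uniqw.
Qed.

Lemma induced_tree g A r : symmetric g -> irreflexive g ->
  (forall c, cycle g c -> uniq c -> (size c <= 2)%N) ->
  r \in A -> (forall v, v \in A -> connect (induced g A) r v) ->
  tree A (induced g A).
Proof.
move=> gs gi acyc rA conA; have symA := sym_connect_sym (induced_sym A gs).
split; split.
- exact: induced_sym.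
- by move=> v; rewrite /induced gi !andbF.
- by move=> v w /and3P[-> ->].
- by apply/set0Pn; exists r.
- by move=> v w vA wA; apply: connect_trans (conA w wA); rewrite symA conA.
- move=> c; case: c => // x s cs; apply: acyc.
  by apply: sub_path cs => y z /and3P[].
Qed.

(** No edge leaves the pair, so by connectedness it is the whole graph. *)
Lemma adjacent_leaves g u v : tree [set: T] g -> g u v -> leaf g u -> leaf g v ->
  forall w, (w == u) || (w == v).
Proof.
case=> -[gs gi _] [_ gcon _] uv /eqP lu /eqP lv w.
have nbr1 a b : deg g a = 1 -> g a b -> forall c, g a c -> c = b.
  move=> /eqP /cards1P[z Nz] ab c ac.
  have : c \in nbr g a by rewrite inE.
  have : b \in nbr g a by rewrite inE.
  by rewrite Nz !inE => /eqP-> /eqP->.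
apply/negP => /negP nw.
have [|a [b [aA bA ab]]] :=
  @connect_crossing g [set u; v] u w (gcon _ _ (in_setT _) (in_setT _)) (set21 _ _).
  by rewrite !inE.
move: bA; rewrite !inE => /norP[bu bv].
case/set2P: aA => E; rewrite E in ab.
  by rewrite (nbr1 _ _ lu uv _ ab) eqxx in bv.
by rewrite gs in uv; rewrite (nbr1 _ _ lv uv _ ab) eqxx in bu.
Qed.

(** A nonempty closed walk can be shortened to a simple cycle. *)
Lemma acyclic_uniq d :
  (forall c, cycle d c -> uniq c -> c = [::]) -> acyclic d.
Proof.
move=> H [|x s] //; rewrite /= rcons_path => /andP[xs].
case/shortenP: xs => s' xs' us' _ sx.
by have := H (x :: s'); rewrite /= rcons_path xs' sx => /(_ isT us').
Qed.

(** Loops are excluded by irreflexivity, 2-cycles by antisymmetry, and longer simple cycles because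
    they would be cycles of the tree. *)
Lemma tree_orientation_acyclic U g d : tree U g -> subrel d g ->
  (forall v w, d v w -> ~~ d w v) -> acyclic d.
Proof.
case=> -[gs gi _] [_ _ acyc] dg asym; apply: acyclic_uniq => c dc uc.
have := acyc c; case: c => [|a [|b [|z c]]] // in dc uc *.
- by move: dc => /=; rewrite andbT => /dg; rewrite gi.
- by move: dc => /= /and3P[ab ba _]; have := asym _ _ ab; rewrite ba.
- by move=> H; have := H (sub_path dg dc) uc.
Qed.

End Trees.

(** * Star coordinates as moments *)

Section StarMoments.
Local Open Scope ring_scope.
Variables (R : realType) (p : nat) (e : rel 'I_p) (I : {set 'I_p}).
Hypothesis e_irr : irreflexive e.
Variable x : cim_space R e I.
Implicit Types (P : {set 'I_p} -> R) (v u c : 'I_p) (A B S L : {set 'I_p}).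
Local Notation N := (nbr e).

(** If [P S] is the probability that [S] is the parent set of [v], the right-hand side is the
    probability that all of [B] are parents. Only the values of [P] on sets with at least two
    elements are constrained. *)
Definition upsum v P := forall B, B \subset N v -> (2 <= #|B|)%N ->
  coordG x (v |: B) = \sum_(S : {set 'I_p} | (S \subset N v) && (B \subset S)) P S.

(** The candidate probability that the parent set of [v] is [S]. It is meaningful for at least two
    elements; below that it reads default values at sets that are not stars. *)
Definition mobius v S : R :=
  \sum_(B : {set 'I_p} | (S \subset B) && (B \subset N v))
    (-1) ^+ #|B :\: S| * coordG x (v |: B).

(** Möbius inversion. Every point is thus represented by possibly negative weights, and the star
    inequalities will ask for their nonnegativity. *)
Lemma upsum_mobius v : upsum v (mobius v).
Proof.
move=> B BN B2; rewrite /mobius.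
rewrite (exchange_big_dep (fun C : {set 'I_p} => (B \subset C) && (C \subset N v))) /=; last first.
  by move=> S C /andP[_ BS] /andP[SC ->]; rewrite (subset_trans BS SC).
rewrite (bigD1 B) /=; last by rewrite subxx BN.
rewrite [X in _ + X]big1 ?addr0; last first.
  move=> C /andP[/andP[BC CN] neqCB].
  rewrite -mulr_suml; have := sum_signB_interval R B C; rewrite eq_sym (negPf neqCB) => H.
  rewrite -[RHS](mul0r (coordG x (v |: C))) -[X in _ = X * _]H; congr (_ * _).
  apply: eq_bigl => S.
  apply/andP/andP => [[/andP[SN ->] /andP[-> _]]//|[-> SC]].
  by rewrite SC CN (subset_trans SC CN).
rewrite (bigD1 B) /=; last by rewrite subxx BN.
rewrite setDv cards0 mul1r big1 ?addr0 // => S /andP[/andP[/andP[_ BS] /andP[SB _]]].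
by rewrite eqEsubset BS SB.
Qed.

Lemma mobius_upsum v P S : upsum v P -> S \subset N v -> (2 <= #|S|)%N ->
  mobius v S = P S.
Proof.
move=> uP SN S2; rewrite /mobius.
under eq_bigr => B /andP[SB BN].
  rewrite uP // ?(leq_trans S2) ?subset_leq_card // mulr_sumr; over.
rewrite (exchange_big_dep (fun C : {set 'I_p} => (S \subset C) && (C \subset N v))) /=; last first.
  by move=> B C /andP[SB _] /andP[-> BC]; rewrite (subset_trans SB BC).
rewrite (bigD1 S) /=; last by rewrite subxx SN.
rewrite [X in _ + X]big1 ?addr0; last first.
  move=> C /andP[/andP[SC CN] neqCS].
  rewrite -mulr_suml; have := sum_signD_interval R S C; rewrite eq_sym (negPf neqCS) => H.
  rewrite -[RHS](mul0r (P C)) -[X in _ = X * _]H; congr (_ * _).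
  apply: eq_bigl => B.
  apply/andP/andP => [[/andP[-> _] /andP[_ ->]]//|[-> BC]].
  by rewrite BC CN (subset_trans BC CN).
rewrite (bigD1 S) /=; last by rewrite subxx SN.
rewrite setDv cards0 mul1r big1 ?addr0 // => B /andP[/andP[/andP[SB _] /andP[_ BS]]].
by rewrite eqEsubset BS SB.
Qed.

(** Inclusion-exclusion: the alternating sum over nonempty subsets of [S :\ u] is 1 unless [S :\ u]
    is empty. So [arrow] is the probability that [u] is a parent of [v] but not the only one. *)
Lemma arrow_upsum v u P : v \notin I -> e v u -> upsum v P ->
  arrow x v u =
    \sum_(S : {set 'I_p} | (S \subset N v) && ((2 <= #|S|)%N && (u \in S))) P S.
Proof.
move=> vI vu uP; rewrite /arrow (negPf vI).
transitivity (\sum_(A : {set 'I_p} | (A != set0) && (A \subset N v :\ u))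
   \sum_(S : {set 'I_p} | S \subset N v)
     P S * ((u \in S)%:R * ((-1) ^+ #|A|.+1 *+ (A \subset S)))).
  apply: eq_bigr => A /andP[A0 /subsetD1P[AN uA]].
  have -> : A :|: [set u; v] = v |: (u |: A).
    by apply/setP => w; rewrite !inE; case: (w == v); case: (w == u); rewrite ?orbT ?orbF.
  rewrite uP; last 2 first.
  - by rewrite subUset sub1set inE vu.
  - by rewrite cardsU1 uA ltnS card_gt0.
  rewrite mulr_sumr big_mkcondr /=; apply: eq_bigr => S SN.
  rewrite subUset sub1set; case: (u \in S); rewrite ?mul0r ?mulr0 //= mul1r.
  by case: (A \subset S); rewrite ?mulr0 // mulrC.
rewrite exchange_big big_mkcondr /=; apply: eq_bigr => S SN.
rewrite -mulr_sumr -mulr_sumr.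
case: (boolP (u \in S)) => uS; last by rewrite andbF mul0r mulr0.
rewrite andbT mul1r.
have -> : \sum_(A : {set 'I_p} | (A != set0) && (A \subset N v :\ u))
    (-1) ^+ #|A|.+1 *+ (A \subset S) = 1 - (S :\ u == set0)%:R :> R.
  rewrite -(sum_sign_subset R) [in RHS](bigD1 set0) ?sub0set //= cards0 expr0.
  rewrite opprD addrA subrr add0r -sumrN.
  rewrite big_mkcond [RHS]big_mkcond; apply: eq_bigr => A _.
  rewrite !subsetD1; case: (A == set0); rewrite ?andbF //= andbT.
  case: (boolP (A \subset S)) => AS; last by case: ifP.
  by rewrite (subset_trans AS SN); case: (u \notin A) => //=; rewrite mulr1n exprS mulN1r.
have -> : (S :\ u == set0) = ~~ (2 <= #|S|)%N.
  by rewrite -cards_eq0 (cardsD1 u S) uS; case: #|_|.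
by case: ifP => _ /=; rewrite ?subr0 ?subrr ?mulr1 ?mulr0.
Qed.

Lemma sum_star c L (F : {set 'I_p} -> R) : c \notin L ->
  \sum_(A : {set 'I_p} | [&& c \in A, A \subset c |: L & (3 <= #|A|)%N]) F A
    = \sum_(B : {set 'I_p} | (B \subset L) && (2 <= #|B|)%N) F (c |: B).
Proof.
move=> cL.
rewrite (reindex_onto (fun B => c |: B) (fun A => A :\ c)) /=; last first.
  by move=> A /andP[cA _]; rewrite setD1K.
apply: eq_bigl => B; rewrite setU11 /=.
case: (boolP (c \in B)) => cB.
  have -> : ((c |: B) :\ c == B) = false.
    by apply/eqP => /setP/(_ c); rewrite !inE eqxx cB.
  rewrite andbF; case: (boolP (B \subset L)) => // /subsetP/(_ _ cB).
  by rewrite (negPf cL).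
rewrite setU1K // eqxx andbT cardsU1 cB ltnS; congr (_ && _).
apply/idP/idP => [/subsetP H|]; last exact: setUS.
apply/subsetP => w wB; have := H w; rewrite !inE wB orbT => /(_ isT).
by case: eqP => // E; rewrite -E wB in cB.
Qed.

Lemma nbr_irr c : c \notin N c. Proof. by rewrite inE e_irr. Qed.

(** The coefficient is the number of parents inside the subtree beyond the first: 0 if there are
    none, and their number minus 1 otherwise. *)
Lemma sharp_upsum (f : rel 'I_p) c P : subrel f e -> upsum c P ->
  sharp f x c = \sum_(S : {set 'I_p} | S \subset N c)
    P S * ((S :&: nbr f c == set0)%:R - 1 + #|S :&: nbr f c|%:R).
Proof.
move=> fe uP; have NfN : nbr f c \subset N c.
  by apply/subsetP => w; rewrite !inE; apply: fe.
have cf : c \notin nbr f c := contra (subsetP NfN c) (nbr_irr c).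
rewrite /sharp /cnbr sum_star //.
transitivity (\sum_(B : {set 'I_p} | (B \subset nbr f c) && (2 <= #|B|)%N)
   \sum_(S : {set 'I_p} | S \subset N c) P S * ((-1) ^+ #|B| *+ (B \subset S))).
  apply: eq_bigr => B /andP[Bf B2]; have BN := subset_trans Bf NfN.
  rewrite uP // mulr_sumr big_mkcondr /=; apply: eq_bigr => S SN.
  rewrite cardsU1 (contra (subsetP Bf c) cf) add1n subn1 /=.
  by case: (B \subset S); rewrite ?mulr0 // mulrC.
rewrite exchange_big /=; apply: eq_bigr => S SN; rewrite -mulr_sumr.
congr (_ * _); rewrite -sum_sign_card_ge2 big_mkcond [RHS]big_mkcond.
apply: eq_bigr => B _; rewrite subsetI.
by case: (B \subset S); case: (B \subset nbr f c) => //=; case: ifP.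
Qed.

(** The alternating sum over [B] eliminates the parent sets meeting [L], and the weighted sum over
    [A] becomes the indicator of at least two parents. *)
Lemma out_ind_upsum c L P : L \subset N c -> upsum c P ->
  out_ind x c L = \sum_(S : {set 'I_p} | S \subset N c)
    P S * ((S :&: L == set0) && (2 <= #|S|)%N)%:R.
Proof.
move=> LN uP; have cL : c \notin L := contra (subsetP LN c) (nbr_irr c).
have E : cnbr e c :\: L = c |: (N c :\: L).
  by rewrite /cnbr setDUl; congr (_ :|: _); apply/setDidPl; rewrite disjoints1.
rewrite /out_ind E sum_star ?inE ?(negPf (nbr_irr c)) ?andbF //; last first.
  by rewrite e_irr andbF.
(* The centre has been removed from [A], so the weight [#|A| - 2] becomes [#|A| - 1]; as [A] and [B]
   are disjoint, the sign factors. *)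
transitivity (\sum_(A : {set 'I_p} | (A \subset N c :\: L) && (2 <= #|A|)%N)
   \sum_(S : {set 'I_p} | S \subset N c)
   P S * (((-1) ^+ #|A| * (#|A| - 1)%:R *+ (A \subset S)) * 
     (\sum_(B : {set 'I_p} | B \subset L) ((-1) ^+ #|B| *+ (B \subset S))))).
  apply: eq_bigr => A /andP[/subsetDP[AN AL] A2].
  have cA : c \notin A := contra (subsetP AN c) (nbr_irr c).
  rewrite [RHS](eq_bigr _ (fun S _ => mulrA _ _ _)).
  rewrite [RHS](eq_bigr _ (fun S _ => mulr_sumr _ _ _ _)) [RHS]exchange_big /=.
  apply: eq_bigr => B BL; have BN := subset_trans BL LN.
  have cB : c \notin B := contra (subsetP BL c) cL.
  have cAB : c \notin A :|: B by rewrite inE negb_or cA.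
  have cardAB : #|A :|: B| = (#|A| + #|B|)%N.
    rewrite cardsU disjoint_setI0 ?cards0 ?subn0 //.
    exact: disjointWr BL AL.
  rewrite -setUA uP; last 2 first.
  - by rewrite subUset AN.
  - by rewrite cardAB (leq_trans A2) // leq_addr.
  rewrite mulr_sumr big_mkcondr /=; apply: eq_bigr => S SN.
  rewrite subUset !cardsU1 cA cAB !add1n !subSS subn0 cardAB exprD.
  by case: (A \subset S); case: (B \subset S); rewrite /= ?mulr0n ?mulr1n ?mulr0 ?mul0r //; ring.
rewrite exchange_big /=; apply: eq_bigr => S SN; rewrite -mulr_sumr; congr (_ * _).
rewrite -mulr_suml.
have -> : \sum_(B : {set 'I_p} | B \subset L) (-1) ^+ #|B| *+ (B \subset S)
    = (S :&: L == set0)%:R :> R.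
  rewrite -sum_sign_subset big_mkcond [RHS]big_mkcond; apply: eq_bigr => B _.
  by rewrite subsetI; case: (B \subset S); case: (B \subset L).
case: eqVneq => [SL|_]; last by rewrite mulr0.
rewrite mulr1 /= -sum_sign_predcard_ge2 big_mkcond [RHS]big_mkcond.
have SNL : S \subset N c :\: L by rewrite subsetD SN -setI_eq0 SL eqxx.
apply: eq_bigr => A _; case: (boolP (A \subset S)) => AS /=.
  by rewrite (subset_trans AS SNL).
by case: ifP.
Qed.

(** The indicators of having no parent in the subtree cancel, leaving a coefficient that is affine
    in the number of such parents. Parent sets with fewer than two elements contribute to neither
    term. *)
Lemma out_ind_sub_sharp (f : rel 'I_p) c P : subrel f e -> upsum c P ->
  out_ind x c (nbr f c) - sharp f x c =
  \sum_(S : {set 'I_p} | (S \subset N c) && (2 <= #|S|)%N)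
    P S * (1 - #|S :&: nbr f c|%:R).
Proof.
move=> fe uP; have NfN : nbr f c \subset N c.
  by apply/subsetP => w; rewrite !inE; apply: fe.
rewrite (out_ind_upsum NfN uP) (sharp_upsum fe uP) -sumrB big_mkcondr /=.
apply: eq_bigr => S SN; rewrite -mulrBr; set Y := S :&: nbr f c.
case: (boolP (2 <= #|S|)%N) => S2; first by rewrite andbT; ring.
rewrite andbF; suff -> : (Y == set0)%:R - 1 + #|Y|%:R = 0 :> R by rewrite subrr mulr0.
have : (#|Y| < 2)%N by apply: leq_ltn_trans (subset_leq_card (subsetIl _ _)) _; rewrite ltnNge.
by rewrite -cards_eq0; case: #|Y| => [|[|k]] //= _; ring.
Qed.

(** With fewer than two neighbours outside the subtree no star qualifies. This lets the sum over
    [fork_nodes] run over all of [U]; [sharp_eq0] does the same for [inner_nodes]. *)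
Lemma out_ind_eq0 (f : rel 'I_p) c : subrel f e -> (deg e c - deg f c < 2)%N ->
  out_ind x c (nbr f c) = 0.
Proof.
move=> fe dc; have NfN : nbr f c \subset N c.
  by apply/subsetP => w; rewrite !inE; apply: fe.
rewrite /out_ind big_pred0 // => A; apply/negP => /and3P[cA AN A3].
move: dc; rewrite ltnNge => /negP[].
have := subset_leq_card AN; have cf : c \notin nbr f c := contra (subsetP NfN c) (nbr_irr c).
rewrite /cnbr setDUl (setDidPl _) ?disjoints1 // cardsU1 inE (negPf (nbr_irr c)) andbF.
rewrite cardsD (setIidPr NfN) add1n => le; rewrite -ltnS.
exact: leq_trans A3 le.
Qed.

Lemma sharp_eq0 (f : rel 'I_p) c : (deg f c < 2)%N -> sharp f x c = 0.
Proof.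
move=> dc; rewrite /sharp big_pred0 // => A; apply/negP => /and3P[cA AN A3].
have := leq_trans A3 (leq_trans (subset_leq_card AN) (leq_card_setU _ _)).
by rewrite cards1 add1n ltnS leqNgt dc.
Qed.

End StarMoments.

(** * Gluing local distributions along a tree *)

Section Gluing.
Local Open Scope ring_scope.
Variables (R : realFieldType) (T : finType) (f : rel T).
Variable q : T -> {set T} -> R.
Hypothesis q_ge0 : forall v S, 0 <= q v S.
Hypothesis q_sum1 : forall v, \sum_S q v S = 1.
Hypothesis q_edge : forall u v, f u v ->
  \sum_(S : {set T} | u \in S) q v S + \sum_(S : {set T} | v \in S) q u S = 1.

(* [sigma k v] is the set of parents of v in the k-th orientation *)
Definition glued (A : {set T}) : Prop :=
  exists (K : finType) (w : K -> R) (sigma : K -> T -> {set T}),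
  [/\ forall k, 0 <= w k, \sum_k w k = 1,
      forall v S, v \in A -> \sum_(k | sigma k v == S) w k = q v S
    & forall k u v, w k != 0 -> u \in A -> v \in A -> f u v ->
        (u \in sigma k v) = (v \notin sigma k u)].

Lemma sum_sigma (K : finType) (w : K -> R) (sigma : K -> {set T}) (v : T)
    (P : pred {set T}) :
  (forall S, \sum_(k | sigma k == S) w k = q v S) ->
  \sum_(k | P (sigma k)) w k = \sum_(S : {set T} | P S) q v S.
Proof.
move=> H; rewrite (partition_big sigma P) //=; apply: eq_bigr => S PS.
by rewrite -H; apply: eq_bigl => k; case: eqP => [->|]; rewrite ?PS ?andbF.
Qed.

(* The orientations around the new vertex u are coupled with those of A
   through the only edge they share, conditionally on its direction. *)
Lemma glued_step (A : {set T}) u a : symmetric f -> irreflexive f ->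
  u \notin A -> a \in A -> f u a -> (forall a', a' \in A -> f u a' -> a' = a) ->
  glued A -> glued (u |: A).
Proof.
move=> fs fi uA aA ua uniqa [K [w [sigma [w0 w1 wq wf]]]].
pose beta k := u \in sigma k a.
(* The probability of the direction [b] of the shared edge, as seen from [u]; by [q_edge] it is the
   same as seen from [a], which is [DE]. *)
pose D b := \sum_(S : {set T} | (a \in S) == ~~ b) q u S.
have D0 b : 0 <= D b by apply: sumr_ge0.
have DE b : \sum_(k | beta k == b) w k = D b.
  rewrite (@sum_sigma _ w (fun k => sigma k a) a (fun S => (u \in S) == b)) => [|S]; last exact: wq.
  have Eua := q_edge ua.
  have Ea := q_sum1 a; rewrite (bigID (fun S : {set T} => u \in S)) /= in Ea.
  have Eu := q_sum1 u; rewrite (bigID (fun S : {set T} => a \in S)) /= in Eu.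
  rewrite (eq_bigl (fun S : {set T} => if b then u \in S else u \notin S)); last first.
    by move=> S; case: b; case: (_ \in _).
  rewrite /D [RHS](eq_bigl (fun S : {set T} => if b then a \notin S else a \in S)); last first.
    by move=> S; case: b; case: (_ \in _).
  by case: b; lra.
(* Where [D] vanishes, the quotient in [w'] is 0 by convention; this fact and [qD] show that the
   marginals to be matched are 0 there as well. *)
have wD k : D (beta k) = 0 -> w k = 0.
  move=> D_0; apply/eqP; rewrite eq_le w0 andbT -D_0 -DE (bigD1 k) //=.
  by rewrite lerDl sumr_ge0.
have qD (S : {set T}) : D (a \notin S) = 0 -> q u S = 0.
  move=> D_0; apply/eqP; rewrite eq_le q_ge0 andbT -D_0 /D negbK (bigD1 S) //=.
  by rewrite lerDl sumr_ge0.
(* Conditional independence given the direction of the shared edge. *)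
pose w' (z : K * {set T}) := (beta z.1 == (a \notin z.2))%:R * (w z.1 * q u z.2 / D (beta z.1)).
pose sigma' (z : K * {set T}) v := if v == u then z.2 else sigma z.1 v.
have w'0 z : 0 <= w' z by rewrite /w' !mulr_ge0 ?invr_ge0 ?ler0n.
have margK k : \sum_S w' (k, S) = w k.
  transitivity (w k / D (beta k) * D (beta k)).
    rewrite /D mulr_sumr [RHS]big_mkcond; apply: eq_bigr => S _.
    rewrite /w' /= -(inj_eq negb_inj) negbK eq_sym; case: ifP => _.
      by rewrite mul1r mulrAC.
    by rewrite mul0r.
  by case: (eqVneq (D (beta k)) 0) => [/[dup] /wD -> ->|D_neq]; rewrite ?mulr0 ?divfK.
have margS S : \sum_k w' (k, S) = q u S.
  transitivity (D (a \notin S) * (q u S / D (a \notin S))).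
    rewrite -DE mulr_suml [RHS]big_mkcond; apply: eq_bigr => k _.
    rewrite /w' /=; case: eqP => [->|_]; last by rewrite mul0r.
    by rewrite DE mul1r mulrA.
  case: (eqVneq (D (a \notin S)) 0) => [/[dup] /qD -> ->|D_neq].
    by rewrite mul0r.
  by rewrite mulrC divfK.
exists (K * {set T})%type, w', sigma'; split=> //.
- by rewrite -(pair_bigA _ (fun k S => w' (k, S))) /= -w1; apply: eq_bigr.
- move=> v S; rewrite /sigma'; case: (eqVneq v u) => [-> _|vu /setU1P[/eqP|vA]].
  + rewrite -(pair_big xpredT (fun X => X == S) (fun k S => w' (k, S))) /= -margS.
    by apply: eq_bigr => k _; rewrite big_pred1_eq.
  + by rewrite (negPf vu).
  + rewrite (eq_bigl (fun z : K * {set T} => (sigma z.1 v == S) && true)); last first.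
      by move=> z; rewrite andbT.
    rewrite -wq // -(pair_big (fun k => sigma k v == S) xpredT (fun k S => w' (k, S))) /=.
    by apply: eq_bigr.
- move=> [k X] v1 v2; rewrite /w' /sigma' /= mulf_eq0 negb_or => /andP[bX /=].
  rewrite !mulf_eq0 !negb_or => /andP[/andP[wk _] _].
  move: bX; rewrite pnatr_eq0 eqb0 negbK /beta => /eqP bX.
  case/setU1P => [->|v1A]; case/setU1P => [->|v2A]; rewrite ?eqxx ?fi //.
  + have -> : (v2 == u) = false by apply: contraNF uA => /eqP <-.
    by move=> /(uniqa _ v2A) ->.
  + have -> : (v1 == u) = false by apply: contraNF uA => /eqP <-.
    by rewrite fs => /(uniqa _ v1A) ->; rewrite bX negbK.
  + have -> : (v2 == u) = false by apply: contraNF uA => /eqP <-.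
    have -> : (v1 == u) = false by apply: contraNF uA => /eqP <-.
    exact: wf.
Qed.

Lemma gluing U : tree U f -> glued U.
Proof.
move=> treeU; have [[fs fi _] _] := treeU.
apply: (tree_growth treeU) => [v _|A u a _ _ uA aA ua uniqa]; last exact: (glued_step fs fi uA aA).
(* At a single vertex the parent set itself serves as the index. *)
exists {set T}, (q v), (fun S _ => S); split=> //.
- by move=> v' S /set1P->; rewrite big_pred1_eq.
- by move=> S u1 u2 _ /set1P-> /set1P->; rewrite fi.
Qed.

End Gluing.

(** * The stars of [graphI I e] *)

Section StarsOfGraphI.
Variables (p : nat) (e : rel 'I_p) (I : {set 'I_p}).
Hypothesis treeG : tree [set: 'I_p] e.
Hypothesis leavesI : forall i, i \in I -> leaf e i.
Implicit Types (u v i : 'I_p) (B : {set 'I_p}) (d : rel 'I_p).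
Local Notation N := (nbr e).
Local Notation gI := (graphI I e).

Lemma tree_sym : symmetric e. Proof. by case: treeG => -[]. Qed.
Lemma tree_irr : irreflexive e. Proof. by case: treeG => -[]. Qed.
Lemma tree_acyclic c : cycle e c -> uniq c -> size c <= 2.
Proof. by case: treeG => _ [_ _]; apply. Qed.

Lemma tree_no_triangle a b c : e a b -> e b c -> e c a = false.
Proof.
move=> ab bc; apply/negP => ca; have := @tree_acyclic [:: a; b; c].
rewrite /= ab bc ca !inE negb_or; suff /and3P[-> -> ->] : [&& a != b, a != c & b != c].
  by move=> /(_ isT isT).
by apply/and3P; split; apply/eqP => E; move: ab bc ca; rewrite E tree_irr.
Qed.

Lemma tree_edge_skeleton d u v : skeleton d =2 e -> d u v -> e u v.
Proof. by move=> de uv; rewrite -de /skeleton uv. Qed.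

Lemma mem_emb B v : ((inl v : node I) \in emb I B) = (v \in B).
Proof. by rewrite mem_imset // => ? ? []. Qed.

Lemma mem_embr B (i : {i | i \in I}) : ((inr i : node I) \in emb I B) = false.
Proof. by apply/imsetP => -[]. Qed.

Lemma mem_primedr v (i : {i | i \in I}) : ((inr i : node I) \in primed I v) = (val i == v).
Proof. by rewrite inE. Qed.

Lemma mem_primedl u v : ((inl u : node I) \in primed I v) = false.
Proof. by rewrite inE. Qed.

Local Notation memE := (mem_emb, mem_embr, mem_primedr, mem_primedl).

Lemma graphI_ll u v : gI (inl u) (inl v) = e u v.
Proof. by rewrite /graphI /skeleton /= [e v u]tree_sym orbb. Qed.

Lemma graphI_lr u (i : {i | i \in I}) : gI (inl u) (inr i) = (val i == u).
Proof. by rewrite /graphI /skeleton. Qed.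

Lemma graphI_rl u (i : {i | i \in I}) : gI (inr i) (inl u) = (val i == u).
Proof. by rewrite /graphI /skeleton /= orbF. Qed.

Lemma nbr_graphI v : nbr gI (inl v) = emb I (N v) :|: primed I v.
Proof.
apply/setP => -[w|i]; rewrite !(inE, memE) ?graphI_ll ?graphI_lr ?orbF //.
Qed.

Lemma nbr_graphI_target (i : {i | i \in I}) : nbr gI (inr i) = [set inl (val i)].
Proof.
apply/setP => -[w|j]; rewrite !(inE, memE) ?graphI_rl //.
by rewrite eq_sym.
Qed.

Lemma primed_notin v : v \notin I -> primed I v = set0.
Proof.
move=> vI; apply/setP => -[w|i]; rewrite !(inE, memE) //.
by apply: contraNF vI => /eqP <-; apply: valP.
Qed.

Lemma primed_in v (vI : v \in I) : primed I v = [set inr (exist _ v vI)].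
Proof.
apply/setP => -[w|i]; rewrite !(inE, memE) //.
Qed.

Lemma card_emb B : #|emb I B| = #|B|.
Proof. by rewrite card_imset // => ? ? []. Qed.

Lemma leaf_graphI_target (i : {i | i \in I}) : leaf gI (inr i).
Proof. by rewrite /leaf /deg nbr_graphI_target cards1. Qed.

Lemma emb_primed_disjoint B v : [disjoint emb I B & primed I v].
Proof.
rewrite -setI_eq0; apply/eqP/setP => -[w|i]; rewrite !(inE, memE) ?andbF //.
Qed.

(** A target gains its primed copy as a second neighbour and so ceases to be a leaf. *)
Lemma leaf_graphI v : leaf gI (inl v) = leaf e v && (v \notin I).
Proof.
rewrite {1}/leaf /deg nbr_graphI cardsU disjoint_setI0 ?emb_primed_disjoint //.
rewrite cards0 subn0 card_emb -/(deg e v).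
case: (boolP (v \in I)) => vI; last by rewrite primed_notin // cards0 addn0 andbT.
by rewrite (primed_in vI) cards1 (eqP (leavesI vI)) andbF.
Qed.

Lemma nbr_target i u : i \in I -> e i u -> N i = [set u].
Proof.
move=> /leavesI /cards1P[w Nw] iu; have : u \in N i by rewrite inE.
by rewrite Nw inE => /eqP <-.
Qed.

Definition star_at v B : {set node I} := emb I (v |: B).
Definition target_star i u : {set node I} := emb I [set i; u] :|: primed I i.

Lemma star_at_setD1 v B : v \notin B -> star_at v B :\ inl v = emb I B.
Proof.
move=> vB; apply/setP => -[w|j]; rewrite !(inE, memE) ?andbF //.
by rewrite (inj_eq (@inl_inj _ _)); case: eqVneq => [->|] //; rewrite (negPf vB).
Qed.

Lemma sub_nbr_notin v B : B \subset N v -> v \notin B.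
Proof. by move=> /subsetP BN; apply/negP => /BN; rewrite inE tree_irr. Qed.

Lemma is_star_at v B : B \subset N v -> 2 <= #|B| -> is_star gI (star_at v B).
Proof.
move=> BN B2; apply/existsP; exists (inl v).
rewrite star_at_setD1 ?sub_nbr_notin // card_emb B2 andbT.
rewrite memE setU11 /= nbr_graphI.
by apply: subset_trans (subsetUl _ _); apply: imsetS.
Qed.

Lemma target_star_setD1 i u : e i u -> 
  target_star i u :\ inl i = (inl u : node I) |: primed I i.
Proof.
move=> iu; apply/setP => -[w|j]; rewrite !(inE, memE) ?andbF ?orbF //.
rewrite !(inj_eq (@inl_inj _ _)); case: eqVneq => [->|] //=.
by apply/esym; apply/negP => /eqP E; rewrite E tree_irr in iu.
Qed.

Lemma is_star_target i u : i \in I -> e i u -> is_star gI (target_star i u).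
Proof.
move=> iI iu; apply/existsP; exists (inl i).
rewrite target_star_setD1 // nbr_graphI (nbr_target iI iu).
rewrite /emb imset_set1 subxx (primed_in iI) cardsU1 !(inE, memE) eqxx.
by rewrite cards1.
Qed.

(** A primed node has one neighbour and cannot be a centre; a target has exactly two, hence a single
    star; any other node has no primed neighbour. *)
Lemma starP A : is_star gI A ->
  (exists v B, [/\ B \subset N v, 2 <= #|B| & A = star_at v B]) \/
  (exists i u, [/\ i \in I, e i u & A = target_star i u]).
Proof.
case/existsP => -[v|i] /and3P[cA AN A2]; last first.
  by have := leq_trans A2 (subset_leq_card AN); rewrite nbr_graphI_target cards1.
case: (boolP (v \in I)) => vI.
  right; have /cards1P[u Nu] := leavesI vI.
  have vu : e v u by have := set11 u; rewrite -Nu inE.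
  exists v, u; split=> //; rewrite -(setD1K cA).
  have -> : A :\ inl v = (inl u) |: primed I v.
    apply/eqP; rewrite eqEcard; rewrite nbr_graphI Nu /emb imset_set1 in AN.
    rewrite AN (leq_trans _ A2) // (primed_in vI) cardsU1 !(inE, memE).
    by rewrite cards1.
  by rewrite -target_star_setD1 // setD1K // /target_star !(inE, memE) eqxx.
left; pose B := [set w | (inl w : node I) \in A :\ inl v].
have EA : A :\ inl v = emb I B.
  apply/setP => -[w|j]; rewrite memE; first by rewrite [RHS]inE.
  apply/negP => /(subsetP AN); rewrite nbr_graphI primed_notin // setU0.
  by rewrite memE.
exists v, B; split.
- apply/subsetP => w; rewrite inE => /(subsetP AN).
  by rewrite nbr_graphI !(inE, memE) orbF.
- by rewrite -card_emb -EA.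
- by rewrite -(setD1K cA) EA /star_at /emb imsetU1.
Qed.

Definition pa d v : {set 'I_p} := [set u | d u v].

Lemma cimset_star_at d v B : skeleton d =2 e -> B \subset N v -> 2 <= #|B| ->
  cimset (add_targets I d) (star_at v B) = (B \subset pa d v).
Proof.
move=> de BN B2; have vB := sub_nbr_notin BN.
apply/existsP/subsetP => [[[a|i] /andP[aA /forallP H]] b bB|Bpa].
- rewrite memE in_setU1 in aA; case/orP: aA => [/eqP av|aB].
    have := H (inl b); rewrite av star_at_setD1 // memE bB /= inE //.
  (* A sink [a] other than [v] would form a triangle with [v] and a further element [c] of [B]. *)
  have /card_gt0P[c] : 0 < #|B :\ a| by move: B2; rewrite (cardsD1 a) aB.
  rewrite !inE => /andP[ca cB].
  have eca : e c a.
    apply: (tree_edge_skeleton de); have := H (inl c).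
    by rewrite !(inE, memE) cB orbT andbT (inj_eq (@inl_inj _ _)) ca.
  have eva : e v a by have := subsetP BN a aB; rewrite inE.
  have ecv : e v c by have := subsetP BN c cB; rewrite inE.
  by rewrite tree_sym in eva; rewrite (tree_no_triangle ecv eca) in eva.
- by rewrite memE in aA.
- exists (inl v); rewrite memE setU11 /= star_at_setD1 //.
  apply/forallP => -[b|i]; rewrite memE //=; apply/implyP => /Bpa.
  by rewrite inE.
Qed.

(** Only [i] can be the sink: its primed copy has no parents and no child but [i]. *)
Lemma cimset_target_star d i u : skeleton d =2 e -> i \in I -> e i u ->
  cimset (add_targets I d) (target_star i u) = d u i.
Proof.
move=> de iI iu; have iu' : i != u by apply/eqP => E; rewrite E tree_irr in iu.
apply/existsP/idP => [[[a|j] /andP[aA /forallP H]]|ui].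
- rewrite !(inE, memE) orbF in aA; case/orP: aA => /eqP E.
    have := H (inl u); rewrite !(inE, memE) eqxx orbT orbF andbT E.
    by rewrite (inj_eq (@inl_inj _ _)) eq_sym iu'.
  have := H (inr (exist _ i iI)); rewrite !(inE, memE) /= eqxx E.
  by rewrite (negPf iu').
- by have := H (inl u); rewrite !(inE, memE) eqxx orbT.
- exists (inl i); rewrite !(inE, memE) eqxx /=.
  rewrite target_star_setD1 //; apply/forallP => -[b|j]; rewrite !(inE, memE) ?orbF /=.
    by rewrite (inj_eq (@inl_inj _ _)); apply/implyP => /eqP->.
  by apply/implyP.
Qed.

End StarsOfGraphI.

Local Notation memE := (mem_emb, mem_embr, mem_primedr, mem_primedl).

(** * The polytope in terms of local marginals *)

Section LocalMarginals.
Local Open Scope ring_scope.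
Variables (R : realType) (p : nat) (e : rel 'I_p) (I : {set 'I_p}).
Hypothesis treeG : tree [set: 'I_p] e.
Hypothesis leavesI : forall i, i \in I -> leaf e i.
Implicit Types (x : cim_space R e I) (u v i : 'I_p) (B S : {set 'I_p}).
Local Notation N := (nbr e).
Local Notation gI := (graphI I e).

(* [q v S] is the probability that the set of parents of v is S *)
Record local_marginals x (q : 'I_p -> {set 'I_p} -> R) : Prop := LocalMarginals {
  marg_ge0 : forall v S, 0 <= q v S;
  marg_sum1 : forall v, \sum_S q v S = 1;
  marg_supp : forall v S, q v S != 0 -> S \subset N v;
  marg_edge : forall u v, e u v ->
    \sum_(S : {set 'I_p} | u \in S) q v S + \sum_(S : {set 'I_p} | v \in S) q u S = 1;
  marg_star : forall v, upsum x v (q v);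
  marg_target : forall i u, i \in I -> e i u ->
    coord_target x i u = \sum_(S : {set 'I_p} | u \in S) q i S }.

Lemma star_coordE x (A : {set node I}) (sA : is_star gI A) :
  star_coord x A = x (exist _ A sA).
Proof.
rewrite /star_coord; case: insubP => [s _ vs|]; last by rewrite sA.
by congr (x _); apply: val_inj.
Qed.

Lemma coord_target_star x i u : coord_target x i u = star_coord x (target_star I i u).
Proof. by []. Qed.

Lemma skeleton_pa (d : rel 'I_p) v : skeleton d =2 e -> pa d v \subset N v.
Proof.
move=> de; apply/subsetP => u; rewrite !inE => uv.
by rewrite (tree_sym treeG) -de /skeleton uv.
Qed.

Lemma acyclic_asym (d : rel 'I_p) u v : acyclic d -> skeleton d =2 e -> e u v ->
  d u v = ~~ d v u.
Proof.
move=> ad de uv; have := de u v; rewrite uv /skeleton.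
case duv : (d u v); case dvu : (d v u) => //= _.
by have := ad [:: u; v]; rewrite /= duv dvu => /(_ isT).
Qed.

Lemma CIM_local_marginals x : CIM x -> exists q, local_marginals x q.
Proof.
case=> n [w [y [w0 w1 /fin_all_exists[d yd] xE]]].
have ad k : acyclic (d k) by case: (yd k).
have de k : skeleton (d k) =2 e by case: (yd k).
have xA A (sA : is_star gI A) :
    star_coord x A = \sum_k w k * (cimset (add_targets I (d k)) A)%:R.
  rewrite star_coordE xE sum_ffunE; apply: eq_bigr => k _.
  by rewrite ffunE; case: (yd k) => _ _ ->; rewrite ffunE.
pose q v S := \sum_k w k * (pa (d k) v == S)%:R.
have qP v (P : pred {set 'I_p}) :
    \sum_(S | P S) q v S = \sum_k w k * (P (pa (d k) v))%:R.
  rewrite /q exchange_big /=; apply: eq_bigr => k _; rewrite -mulr_sumr.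
  congr (_ * _); rewrite big_mkcond (bigD1 (pa (d k) v)) //= eqxx big1 => [|S /negPf nS].
    by rewrite addr0; case: (P _).
  by rewrite eq_sym nS; case: (P S).
exists q; split.
- by move=> v S; apply: sumr_ge0 => k _; rewrite mulr_ge0 ?ler0n.
- by move=> v; rewrite (qP v xpredT) -[RHS]w1; apply: eq_bigr => k _; rewrite /= mulr1.
- move=> v S; apply: contraNT => NS; apply/eqP; apply: big1 => k _.
  case: eqP => [E|_]; last by rewrite mulr0.
  by rewrite -E skeleton_pa in NS.
- move=> u v uv; rewrite !qP -[RHS]w1 -big_split; apply: eq_bigr => k _ /=.
  rewrite !inE (acyclic_asym (ad k) (de k) uv).
  by case: (d k v u) => /=; ring.
- move=> v B BN B2; rewrite qP /coordG xA; last exact: is_star_at.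
  apply: eq_bigr => k _; rewrite (cimset_star_at I treeG (de k)) //.
  by rewrite skeleton_pa.
- move=> i u iI iu; rewrite qP coord_target_star xA; last exact: is_star_target.
  by apply: eq_bigr => k _; rewrite (cimset_target_star treeG) // inE.
Qed.

(** The glued orientations provide the convex combination; by [starP] it suffices to compare the two
    kinds of coordinates described by [marg_star] and [marg_target]. *)
Lemma local_marginals_CIM x q : local_marginals x q -> CIM x.
Proof.
case=> q0 q1 qs qe qstar qt.
have [K [w [sigma [w0 w1 wq wf]]]] := gluing q0 q1 qe treeG.
pose ok k := [forall u, forall v, e u v ==> ((u \in sigma k v) == (v \notin sigma k u))].
have w_ok k : w k != 0 -> ok k.
  move=> wk; apply/forallP => u; apply/forallP => v; apply/implyP => uv.
  by apply/eqP; apply: wf; rewrite ?inE.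
(* An index of weight zero need not describe an orientation, yet every index of the combination
   needs a DAG. A consistent index [k0] stands in for it. *)
have [k0 ok0] : exists k0, ok k0.
  case: (pickP (fun k => w k != 0)) => [k /w_ok|w_0]; first by exists k.
  move: w1; rewrite big1 => [/esym/eqP|k _]; first by rewrite oner_eq0.
  by apply/eqP; have := w_0 k => /negbFE.
pose d k : rel 'I_p := fun u v => e u v && (u \in sigma (if ok k then k else k0) v).
have dE k u v : e u v -> d k u v = ~~ d k v u.
  move=> uv; rewrite /d uv [e v u](tree_sym treeG) uv /=.
  have : ok (if ok k then k else k0) by case: ifP.
  by move=> /forallP/(_ u)/forallP/(_ v)/implyP/(_ uv)/eqP.
have de k : skeleton (d k) =2 e.
  move=> u v; rewrite /skeleton; case: (boolP (e u v)) => uv.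
    by rewrite (dE _ _ _ uv) orNb.
  by rewrite /d [e v u](tree_sym treeG) (negPf uv).
have ad k : acyclic (d k).
  apply: (tree_orientation_acyclic treeG) => [u v /andP[]//|u v].
  by move=> /[dup] /andP[uv _]; rewrite (dE _ _ _ uv).
have xE : x = \sum_k w k *: cim_point R e I (d k) :> cim_space R e I.
  have key A (P : 'I_p -> pred {set 'I_p}) v (sA : is_star gI A) :
      (forall k, ok k -> cimset (add_targets I (d k)) A = P v (sigma k v)) ->
      \sum_(S | P v S) q v S = \sum_k w k * (cimset (add_targets I (d k)) A)%:R.
    move=> PA; rewrite -(@sum_sigma _ _ q K w (sigma ^~ v) v); last first.
      by move=> S; rewrite wq ?inE.
    rewrite big_mkcond; apply: eq_bigr => k _.
    case: (eqVneq (w k) 0) => [->|/w_ok/PA->]; first by rewrite mul0r if_same.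
    by case: (P v _); rewrite ?mulr1 ?mulr0.
  apply/ffunP => -[A sA]; rewrite sum_ffunE.
  transitivity (\sum_k w k * (cimset (add_targets I (d k)) A)%:R); last first.
    by apply: eq_bigr => k _; rewrite !ffunE.
  rewrite -(star_coordE x sA).
  case: (starP treeG leavesI sA) => [[v [B [BN B2 AE]]]|[i [u [iI iu AE]]]].
    rewrite AE -/(coordG x (v |: B)) qstar // -(key _ (fun v S => B \subset S) v); first last.
    - move=> k okk; rewrite (cimset_star_at I treeG (de k)) //.
      apply/subsetP/subsetP => Bpa b bB; have := Bpa b bB; rewrite inE /d okk.
        by case/andP.
      by move=> ->; rewrite [e b v](tree_sym treeG); have := subsetP BN b bB; rewrite inE => ->.
    - exact: is_star_at.
    rewrite big_mkcondl; apply: eq_bigr => S _; case: ifP => // /negbT NS.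
    by apply/esym/eqP; apply: contraNT NS => /qs.
  rewrite AE -coord_target_star qt // (key (target_star I i u) (fun _ S => u \in S) i) //.
    exact: is_star_target.
  move=> k okk; rewrite (cimset_target_star treeG (de k)) // /d okk.
  by rewrite [e u i](tree_sym treeG) iu.
exists #|K|, (fun j => w (enum_val j)), (fun j => cim_point R e I (d (enum_val j))).
split=> //.
- by rewrite -(big_enum_val w) -[RHS]w1; apply: eq_bigl.
- by move=> j; exists (d (enum_val j)).
- rewrite [LHS]xE.
  rewrite -(big_enum_val (fun k => w k *: cim_point R e I (d k) : cim_space R e I)).
  by apply: eq_bigl.
Qed.

End LocalMarginals.

(** * Necessity of the inequalities *)

Section Inequalities.
Local Open Scope ring_scope.
Variables (R : realType) (p : nat) (e : rel 'I_p) (I : {set 'I_p}).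
Hypothesis treeG : tree [set: 'I_p] e.
Hypothesis leavesI : forall i, i \in I -> leaf e i.
Implicit Types (x : cim_space R e I) (u v i c : 'I_p) (B S U : {set 'I_p}).
Implicit Types (f : rel 'I_p).
Local Notation N := (nbr e).
Local Notation gI := (graphI I e).

Let e_sym := tree_sym treeG.
Let e_irr := tree_irr treeG.

Lemma target_deg i S : i \in I -> S \subset N i -> (#|S| <= 1)%N.
Proof. by move=> /leavesI /eqP <-; apply: subset_leq_card. Qed.

Lemma cnbr_graphI v : v \notin I -> cnbr gI (inl v) = star_at I v (N v).
Proof.
by move=> vI; rewrite /cnbr (nbr_graphI _ treeG) primed_notin // setU0 /star_at /emb imsetU1.
Qed.

Lemma cnbr_graphI_target i u : i \in I -> e i u -> cnbr gI (inl i) = target_star I i u.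
Proof.
move=> iI iu; rewrite /cnbr (nbr_graphI _ treeG) (nbr_target leavesI iI iu) /emb imset_set1.
rewrite -(target_star_setD1 _ treeG) // setD1K //.
by rewrite /target_star !(inE, memE) eqxx.
Qed.

Lemma star_at_subset v B S : v \notin B -> (star_at I v B \subset star_at I v S) = (B \subset S).
Proof.
move=> vB; apply/subsetP/subsetP => H w wB.
  have := H (inl w); rewrite !(inE, memE) wB orbT => /(_ isT).
  by case: eqP => // E; rewrite -E wB in vB.
move: w wB => [w|j]; rewrite !(inE, memE) //.
by case/orP => [->//|/H->]; rewrite orbT.
Qed.

Definition unstar v (A : {set node I}) : {set 'I_p} := [set w | inl w \in A :\ inl v].

Lemma star_atK v B : v \notin B -> unstar v (star_at I v B) = B.
Proof. by move=> vB; apply/setP => w; rewrite inE star_at_setD1 // memE. Qed.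

Lemma unstarK v (A : {set node I}) : inl v \in A -> A \subset star_at I v (N v) ->
  star_at I v (unstar v A) = A.
Proof.
move=> vA /subsetP AN; apply/setP => -[w|j]; rewrite !(inE, memE) //.
  by rewrite (inj_eq (@inl_inj _ _)); case: eqVneq => [->|].
by apply/esym/negP => /AN; rewrite memE.
Qed.

(** Deleting the centre from each star turns the left-hand side of a star inequality into a Möbius
    inverse. *)
Lemma sum_star_at x v S : S \subset N v ->
  \sum_(A : {set node I} | (star_at I v S \subset A) && (A \subset star_at I v (N v)))
     (-1) ^+ #|A :\: star_at I v S| * star_coord x A = mobius x v S.
Proof.
move=> SN; rewrite /mobius (reindex_onto (star_at I v) (unstar v)) /=; last first.
  move=> A /andP[SA AN]; apply: unstarK => //; apply: (subsetP SA).
  by rewrite memE setU11.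
have sub_notin := sub_nbr_notin treeG.
apply: eq_big => [B|B /andP[/andP[SB BN] /eqP BK]].
  case: (boolP (v \in B)) => vB.
    rewrite (_ : _ == _ = false) ?andbF.
      by apply/esym/negP => /andP[_ /sub_notin]; rewrite vB.
    by apply/eqP => /setP/(_ v); rewrite !inE eqxx vB.
  by rewrite star_atK // eqxx andbT !star_at_subset // sub_notin.
congr ((-1) ^+ _ * _); have vB : v \notin B.
  by rewrite -BK; rewrite !inE eqxx.
rewrite -(card_emb I); apply: eq_card => -[w|j]; rewrite !(inE, memE) // negb_or.
case: eqVneq => [->|] //=; by rewrite (negPf vB) andbF.
Qed.

(** At a target the only admissible [V'] is the whole three-element neighbourhood, so the sum has a
    single term. *)
Lemma star_ineqsP x : star_ineqs x <->
  (forall v S, S \subset N v -> (2 <= #|S|)%N -> 0 <= mobius x v S) /\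
  (forall i u, i \in I -> e i u -> 0 <= coord_target x i u).
Proof.
split=> [H|[Hm Ht] l V' leafl lV V'N V'3].
  split=> [v S SN S2|i u iI iu].
    have vI : v \notin I by apply: contraTN S2 => vI; rewrite -leqNgt (target_deg vI).
    rewrite -sum_star_at // -cnbr_graphI //; apply: H.
    - rewrite leaf_graphI // vI andbT /leaf neq_ltn orbC.
      by rewrite (leq_trans S2) // subset_leq_card.
    - by rewrite memE setU11.
    - by rewrite cnbr_graphI // star_at_subset // (sub_nbr_notin treeG).
    - by rewrite card_emb cardsU1 (sub_nbr_notin treeG) // ltnS.
  have := H (inl i) (target_star I i u); rewrite (cnbr_graphI_target iI iu) subxx.
  rewrite leaf_graphI // iI andbF !(inE, memE) eqxx => /(_ isT isT isT).
  have -> : (2 < #|target_star I i u|)%N.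
    rewrite (cardsD1 (inl i)) (target_star_setD1 _ treeG) // (primed_in iI) cardsU1.
    by rewrite !(inE, memE) eqxx cards1.
  move=> /(_ isT); rewrite (eq_bigl (pred1 (target_star I i u))) => [|A].
    by rewrite big_pred1_eq setDv cards0 mul1r.
  by rewrite /= eqEsubset andbC.
case: l => [v|j] in leafl lV V'N *; last by rewrite leaf_graphI_target in leafl.
case: (boolP (v \in I)) => vI.
  have /cards1P[u Nu] := leavesI vI.
  have vu : e v u by have := set11 u; rewrite -Nu inE.
  rewrite (cnbr_graphI_target vI vu) in V'N *.
  have card3 : #|target_star I v u| = 3.
    rewrite (cardsD1 (inl v)) (target_star_setD1 _ treeG) // (primed_in vI) cardsU1.
    by rewrite !(inE, memE) eqxx cards1.
  have -> : V' = target_star I v u by apply/eqP; rewrite eqEcard V'N card3.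
  rewrite (eq_bigl (pred1 (target_star I v u))) => [|A].
    by rewrite big_pred1_eq setDv cards0 mul1r Ht.
  by rewrite /= eqEsubset andbC.
rewrite cnbr_graphI // in V'N *; rewrite -(unstarK lV V'N) sum_star_at; last first.
  apply/subsetP => w; rewrite !inE => /andP[wv /(subsetP V'N)].
  by rewrite memE !inE; case/orP => // /eqP E; rewrite E eqxx in wv.
have vS : v \notin unstar v V' by rewrite !inE eqxx.
apply: Hm; last first.
  by rewrite -(unstarK lV V'N) card_emb cardsU1 vS in V'3.
by rewrite -(star_at_subset _ vS) unstarK.
Qed.

(** * Forked-tree inequalities in terms of parent sets *)

Section Forked.
Variables (x : cim_space R e I) (P : 'I_p -> {set 'I_p} -> R).
Hypothesis upP : forall v, upsum x v (P v).

(** Targets are leaves of the big tree, so every edge of [f] at a target is a leaf edge. *)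
Lemma sum_target_leaf_edges f (F : 'I_p -> 'I_p -> R) : subrel f e ->
  \sum_(cd in target_leaf_edges I f) F cd.1 cd.2
    = \sum_(c in I) \sum_(d in nbr f c) F c d.
Proof.
move=> fe; rewrite pair_big_dep /=; apply: eq_bigl => -[c d]; rewrite !inE /=.
case: (boolP (c \in I)) => cI; last by rewrite !andbF.
case: (boolP (f c d)) => //= cd; rewrite andbT.
apply/eqP/eqP; rewrite eqn_leq; apply/andP; split; last first.
  by rewrite card_gt0; apply/set0Pn; exists d; rewrite inE.
apply: (target_deg cI); apply/subsetP => w; rewrite !inE; exact: fe.
Qed.

(** Terms outside [fork_nodes] and [inner_nodes] vanish, so both sums extend to [U] and combine by
    [out_ind_sub_sharp]. *)
Lemma forked_ineqE U f : subtree e U f ->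
  (\sum_(c in fork_nodes e U f) out_ind x c (nbr f c)
      + \sum_(cd in target_leaf_edges I f) (1 - coord_target x cd.1 cd.2)
    <= 1 + \sum_(c in inner_nodes U f) sharp f x c)
  = (\sum_(c in U) \sum_(S : {set 'I_p} | (S \subset N c) && (2 <= #|S|)%N)
       P c S * (1 - #|S :&: nbr f c|%:R)
     + \sum_(c in I) \sum_(d in nbr f c) (1 - coord_target x c d) <= 1).
Proof.
case=> _ fe; rewrite (sum_target_leaf_edges (fun c d => 1 - coord_target x c d) fe).
have -> : \sum_(c in fork_nodes e U f) out_ind x c (nbr f c)
    = \sum_(c in U) out_ind x c (nbr f c).
  rewrite (eq_bigl (fun c => (c \in U) && (2 <= deg e c - deg f c)%N)) => [|c]; last by rewrite inE.
  rewrite big_mkcondr; apply: eq_bigr => c _; case: ifP => // /negbT.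
  by rewrite -ltnNge => H; rewrite out_ind_eq0.
have -> : \sum_(c in inner_nodes U f) sharp f x c = \sum_(c in U) sharp f x c.
  rewrite (eq_bigl (fun c => (c \in U) && ~~ leaf f c)) => [|c]; last by rewrite inE.
  rewrite big_mkcondr; apply: eq_bigr => c _; case: ifP => // /negbFE/eqP fc.
  by rewrite sharp_eq0 // fc.
rewrite -(eq_bigr _ (fun c _ => out_ind_sub_sharp e_irr fe (@upP c))) sumrB.
by apply/idP/idP; lra.
Qed.

End Forked.

(** * Local marginals satisfy the inequalities *)

Section Necessity.
Variables (x : cim_space R e I) (q : 'I_p -> {set 'I_p} -> R).
Hypothesis xq : local_marginals x q.

Let Q v u := \sum_(S : {set 'I_p} | u \in S) q v S.

Lemma marg_eq0 v S : ~~ (S \subset N v) -> q v S = 0.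
Proof. by move=> NS; apply/eqP; apply: contraNT NS => /(marg_supp xq). Qed.

(** Off the targets, [arrow] asks for a second parent besides [u]; at a target it is the probability
    of the edge itself. *)
Lemma arrow_le_marg v u : e v u -> arrow x v u <= Q v u.
Proof.
move=> vu; case: (boolP (v \in I)) => vI.
  by rewrite /arrow vI (marg_target xq).
rewrite (arrow_upsum vI vu (@marg_star _ _ _ _ _ _ xq v)).
rewrite /Q [leLHS]big_mkcond [leRHS]big_mkcond; apply: ler_sum => S _.
have := marg_ge0 xq v S; case: (u \in S); rewrite ?andbF // andbT.
by case: ifP.
Qed.

Lemma marg_bidirected : bidirected_ineqs x.
Proof.
move=> u v uv _ _; have vu : e v u by rewrite e_sym.
have := marg_edge xq uv; have := arrow_le_marg uv; have := arrow_le_marg vu.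
by rewrite /Q; lra.
Qed.

Lemma marg_star_ineqs : star_ineqs x.
Proof.
apply/star_ineqsP; split=> [v S SN S2|i u iI iu].
  by rewrite (mobius_upsum (@marg_star _ _ _ _ _ _ xq v) SN S2) (marg_ge0 xq).
rewrite (marg_target xq) //; apply: sumr_ge0 => S _; exact: marg_ge0 xq _ _.
Qed.

Lemma sum_marg_cardI v L :
  \sum_S q v S * #|S :&: L|%:R = \sum_(d in L) Q v d.
Proof.
rewrite /Q (exchange_big_dep xpredT) //=; apply: eq_bigr => S _.
rewrite sumr_const mulr_natr; congr (_ *+ _); apply: eq_card => d.
by rewrite !inE andbC.
Qed.

(** Each edge of the subtree has total probability 1 over its two directions, and there are
    [#|U| - 1] edges. *)
Lemma sum_edge_marg U f : subtree e U f ->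
  \sum_(c in U) \sum_(d in nbr f c) Q c d = #|U|%:R - 1.
Proof.
case=> treeU fe; have [[fs _ fU] _] := treeU.
set X := (LHS).
have E : \sum_(c in U) \sum_(d in nbr f c) (Q c d + Q d c) = (\sum_(c in U) deg f c)%N%:R.
  rewrite natr_sum; apply: eq_bigr => c cU; rewrite /deg -sum1_card natr_sum.
  by apply: eq_bigr => d; rewrite inE => /fe cd; rewrite addrC (marg_edge xq).
have X2 : \sum_(c in U) \sum_(d in nbr f c) Q d c = X.
  rewrite (exchange_big_dep (mem U)) /= => [|c d _]; last by rewrite inE => /fU/andP[].
  apply: eq_bigr => d dU; apply: eq_bigl => c; rewrite !inE fs.
  by apply/andP/idP => [[]//|dc]; have /andP[] := fU _ _ dc.
have := congr1 (fun n => n%:R : R) (tree_sum_deg treeU).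
rewrite natrD natrM -E; under eq_bigr do rewrite big_split.
by rewrite big_split /= X2 -/X; lra.
Qed.

(** The expectation of vertices minus edges of the subtree is 1, summed locally as 1 minus the
    number of parents inside it. The inequality omits the contributions of at most one parent, which
    are nonnegative, and restores them at targets. *)
Lemma marg_forked : forked_tree_ineqs x.
Proof.
move=> U f subU [_ _ _ UI]; rewrite (forked_ineqE (marg_star xq) subU).
have [treeU fe] := subU; have [[fs _ fU] _] := treeU.
have tot : \sum_(c in U) \sum_S q c S * (1 - #|S :&: nbr f c|%:R) = 1.
  have -> : \sum_(c in U) \sum_S q c S * (1 - #|S :&: nbr f c|%:R)
      = \sum_(c in U) (1 - \sum_(d in nbr f c) Q c d).
    apply: eq_bigr => c _; under eq_bigr do rewrite mulrBr mulr1.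
    by rewrite sumrB (marg_sum1 xq) sum_marg_cardI.
  by rewrite sumrB sum_edge_marg // sumr_const; lra.
rewrite -[leRHS]tot.
have -> : \sum_(c in I) \sum_(d in nbr f c) (1 - coord_target x c d)
    = \sum_(c in U) (if c \in I then \sum_(d in nbr f c) (1 - coord_target x c d) else 0).
  rewrite -big_mkcondr /= (bigID (mem U)) /= [X in _ + X]big1 ?addr0.
    by apply: eq_bigl => c; rewrite andbC.
  move=> c /andP[_ cU]; rewrite big_pred0 // => d; rewrite inE.
  by apply: contraNF cU => /fU/andP[].
rewrite -big_split; apply: ler_sum => c cU /=.
rewrite [leRHS](bigID (fun S : {set 'I_p} => (S \subset N c) && (2 <= #|S|)%N)) /=.
rewrite lerD2l; case: (boolP (c \in I)) => cI; last first.
  apply: sumr_ge0 => S; rewrite negb_and; case: (boolP (S \subset N c)) => [SN /=|NS _]; last first.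
    by rewrite marg_eq0 // mul0r.
  rewrite -ltnNge ltnS => S1; rewrite mulr_ge0 ?(marg_ge0 xq) // subr_ge0 lern1.
  by rewrite (leq_trans _ S1) // subset_leq_card // subsetIl.
have /cards1P[d Nd] : leaf f c by apply: UI; rewrite inE cI.
have cd : e c d by apply: fe; have := set11 d; rewrite -Nd inE.
(* A target has one neighbour, so every parent set in the support has at most one element; the
   remaining sum is 1 minus the probability of the edge towards the target. *)
rewrite [leRHS](eq_bigl xpredT) => [|S]; last first.
  apply/idP; rewrite negb_and -implybE -ltnNge ltnS; apply/implyP => SN; exact: target_deg cI SN.
rewrite [leRHS](eq_bigr (fun S => q c S - q c S * #|S :&: nbr f c|%:R)) => [|S _]; last first.
  by rewrite mulrBr mulr1.
by rewrite [leRHS]sumrB (marg_sum1 xq) sum_marg_cardI Nd !big_set1 (marg_target xq).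
Qed.

End Necessity.
End Inequalities.

(** * Sufficiency of the inequalities *)

Section Sufficiency.
Local Open Scope ring_scope.
Variables (R : realType) (p : nat) (e : rel 'I_p) (I : {set 'I_p}).
Hypothesis treeG : tree [set: 'I_p] e.
Hypothesis leavesI : forall i, i \in I -> leaf e i.
Hypothesis nondegenerate : ~ (p = 2%N /\ #|I| = 1%N).
Variable x : cim_space R e I.
Hypotheses (x_star : star_ineqs x) (x_bidir : bidirected_ineqs x).
Hypothesis x_forked : forked_tree_ineqs x.
Implicit Types (u v i c : 'I_p) (B C S W : {set 'I_p}).
Local Notation N := (nbr e).

Let e_sym := tree_sym treeG.
Let e_irr := tree_irr treeG.

(* the probabilities that v has at least two parents, and that moreover u is
   one of them *)
Let many v : R := \sum_(S : {set 'I_p} | (S \subset N v) && (2 <= #|S|)%N) mobius x v S.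
Let many_with v u : R :=
  \sum_(S : {set 'I_p} | (S \subset N v) && ((2 <= #|S|)%N && (u \in S))) mobius x v S.

Lemma mobius_ge0 v S : S \subset N v -> (2 <= #|S|)%N -> 0 <= mobius x v S.
Proof. by case: (iffLR (star_ineqsP treeG leavesI x) x_star) => H _; apply: H. Qed.

Lemma coord_target_ge0 i u : i \in I -> e i u -> 0 <= coord_target x i u.
Proof. by case: (iffLR (star_ineqsP treeG leavesI x) x_star) => _; apply. Qed.

Lemma many_with_ge0 v u : 0 <= many_with v u.
Proof. by apply: sumr_ge0 => S /and3P[SN S2 _]; apply: mobius_ge0. Qed.

Lemma many_with_le v u : many_with v u <= many v.
Proof.
rewrite /many_with /many [leRHS](bigID (fun S : {set 'I_p} => u \in S)) /=.
under eq_bigl do rewrite andbA.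
by rewrite lerDl; apply: sumr_ge0 => S /andP[/andP[]]; move=> *; apply: mobius_ge0.
Qed.

Lemma leaf_small v S : leaf e v -> S \subset N v -> (#|S| < 2)%N.
Proof. by move=> /eqP lv /subset_leq_card; rewrite -/(deg e v) lv. Qed.

Lemma many_leaf v : leaf e v -> many v = 0.
Proof.
move=> lv; apply: big_pred0 => S; apply/negP => /andP[/(leaf_small lv)].
by rewrite ltnNge => /negPf->.
Qed.

Lemma many_with_leaf v u : leaf e v -> many_with v u = 0.
Proof.
move=> lv; apply/eqP; rewrite eq_le many_with_ge0 andbT -(many_leaf lv).
exact: many_with_le.
Qed.

Lemma arrow_nonleaf v u : ~~ leaf e v -> e v u -> arrow x v u = many_with v u.
Proof.
move=> lv vu; apply: arrow_upsum vu (@upsum_mobius _ _ _ _ x v).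
exact: contra (@leavesI v) lv.
Qed.

Lemma arrow_target i u : i \in I -> arrow x i u = coord_target x i u.
Proof. by rewrite /arrow => ->. Qed.

Let interior v := ~~ leaf e v || (v \in I).

Lemma interiorE v : interior v = ~~ leaf (graphI I e) (inl v).
Proof. by rewrite leaf_graphI // negb_and negbK. Qed.

Lemma arrow_ge0 v u : interior v -> e v u -> 0 <= arrow x v u.
Proof.
move=> iv vu; case: (boolP (v \in I)) => vI; first by rewrite arrow_target ?coord_target_ge0.
by rewrite arrow_nonleaf ?many_with_ge0 //; move: iv; rewrite /interior (negPf vI) orbF.
Qed.

(* the probability still to be distributed between the two events that v is
   the only parent of u and that u is the only parent of v *)
Let rest v u : R := 1 - arrow x v u - arrow x u v.

Lemma restC v u : rest v u = rest u v. Proof. by rewrite /rest; ring. Qed.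

Lemma rest_ge0 v u : interior v -> interior u -> e v u -> 0 <= rest v u.
Proof.
rewrite !interiorE => iv iu vu; have := x_bidir vu iv iu.
by rewrite /rest; lra.
Qed.

(* an upper bound for the probability that v has a single parent and that
   this parent is not a target *)
Let capacity v : R := 1 - many v - \sum_(i in I | e v i) rest v i.

(** Twice the capacity minus the edge weight of [W]: the inner sums meet each edge from both
    ends. *)
Let excess W : R :=
  \sum_(v in W) (2 * capacity v - \sum_(u in W | e v u) rest v u).

(** Used to pass to connected components. *)
Lemma excess_split W C : C \subset W ->
  (forall v u, v \in C -> u \in W -> e v u -> u \in C) ->
  excess W = excess C + excess (W :\: C).
Proof.
move=> CW closedC; rewrite /excess (big_setID C) /= (setIidPr CW).
congr (_ + _); apply: eq_bigr => v; rewrite ?inE => vC; congr (_ - _); apply: eq_bigl => u.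
  case: (boolP (u \in C)) => uC /=; first by rewrite (subsetP CW).
  by apply: contraNF uC => /andP[]; apply: closedC.
rewrite inE; case: (boolP (u \in C)) => //= uC.
case/andP: vC => vC vW; apply: contraNF vC => /andP[_ vu].
by apply: (closedC u v) => //; rewrite e_sym.
Qed.

(** The edges at [c] are lost from both ends, whence the factor 2; this is used to prune leaves. *)
Lemma excess_remove W c : c \in W ->
  excess W = excess (W :\ c) + 2 * (capacity c - \sum_(u in W | e c u) rest c u).
Proof.
move=> cW; rewrite /excess (big_setD1 c) //= addrC.
have D1 v : \sum_(u in W | e v u) rest v u
    = (if e v c then rest v c else 0) + \sum_(u in W :\ c | e v u) rest v u.
  rewrite big_mkcondr (big_setD1 c) //=; congr (_ + _).
  by rewrite -big_mkcondr.
rewrite (eq_bigr (fun v => 2 * capacity v - \sum_(u in W :\ c | e v u) rest v u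
    - (if e v c then rest v c else 0))) => [|v _]; last by rewrite D1; ring.
rewrite sumrB.
have -> : \sum_(v in W :\ c) (if e v c then rest v c else 0)
    = \sum_(u in W | e c u) rest c u.
  rewrite D1 e_irr add0r [RHS]big_mkcondr; apply: eq_bigr => v _.
  by rewrite e_sym restC.
by ring.
Qed.

Lemma sum_many_card v L :
  \sum_(S : {set 'I_p} | (S \subset N v) && (2 <= #|S|)%N)
      mobius x v S * (1 - #|S :&: L|%:R)
    = many v - \sum_(d in L) many_with v d.
Proof.
under eq_bigr do rewrite mulrBr mulr1.
rewrite sumrB; congr (_ - _); rewrite /many_with.
rewrite (exchange_big_dep (fun S : {set 'I_p} => (S \subset N v) && (2 <= #|S|)%N)) /=.
  apply: eq_bigr => S /andP[SN S2].
  rewrite sumr_const mulr_natr; congr (_ *+ _); apply: eq_card => d.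
  by rewrite [RHS]unfold_in /= !inE SN S2 andbC.
by move=> d S _ /and3P[-> ->].
Qed.

(** * Connected vertex sets and their forked subtrees *)

Section Connected.
Variables (W : {set 'I_p}) (r : 'I_p).
Hypotheses (W_nonleaf : forall v, v \in W -> ~~ leaf e v) (rW : r \in W).
Hypothesis W_conn : forall v, v \in W -> connect (induced e W) r v.

(** Forkedness demands every target adjacent to the subtree, so these are added to [W]. *)
Let T := W :|: [set i in I | [exists w in W, e i w]].
Let g := induced e T.

Lemma W_notin v : v \in W -> v \notin I.
Proof. by move=> /W_nonleaf; apply: contra; apply: leavesI. Qed.

Lemma mem_T c : (c \in T) = (c \in W) || ((c \in I) && [exists w in W, e c w]).
Proof. by rewrite !inE. Qed.

Lemma nbr_T c : c \in W -> nbr g c = [set u in W :|: I | e c u].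
Proof.
move=> cW; rewrite /g nbr_induced -/T ?mem_T ?cW //.
apply/setP => u; rewrite !inE andbC.
case: (boolP (e c u)) => cu; rewrite ?andbF // !andbT.
case: (u \in W) => //=; case: (u \in I) => //=.
by apply/existsP; exists c; rewrite cW e_sym.
Qed.

Lemma nbr_T_target i d : i \in I -> (d \in nbr g i) = (d \in W) && e i d.
Proof.
move=> iI; rewrite inE /g /induced !mem_T iI /=.
have iW : i \in W = false by apply: contraTF iI; apply: W_notin.
rewrite iW /=; apply/and3P/andP => [[/existsP[w /andP[wW iw]] _ id]|[dW id]].
  have := nbr_target leavesI iI iw; have := nbr_target leavesI iI id.
  by move=> -> /set1_inj ->.
by rewrite dW id; split=> //; apply/existsP; exists d; rewrite dW.
Qed.

Lemma T_tree : tree T g.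
Proof.
apply: (@induced_tree _ _ _ r e_sym e_irr); rewrite ?mem_T ?rW //.
  exact: tree_acyclic treeG.
have mono := sub_connect (@sub_induced _ e W T (subsetUl _ _)).
move=> v; rewrite mem_T; case/orP => [vW|/andP[vI /existsP[w /andP[wW vw]]]].
  exact/mono/W_conn.
apply: connect_trans (mono _ _ (W_conn wW)) (connect1 _).
apply/and3P; split; [by rewrite mem_T wW | | by rewrite e_sym].
by rewrite mem_T vI; apply/orP; right; apply/existsP; exists w; rewrite wW.
Qed.

(** Only the degree condition at leaves has to be assumed; the conditions on targets hold by the
    construction of [T]. *)
Lemma T_forked : (forall u, u \in W -> leaf g u -> (2 <= deg e u - deg g u)%N) ->
  forked e I T g.
Proof.
move=> good; split.
- move=> u; rewrite -interiorE /interior mem_T => /orP[/W_nonleaf->//|/andP[->]].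
  by rewrite orbT.
- move=> u; rewrite mem_T => /orP[uW lu _|/andP[->//]]; exact: good.
- move=> i iI /set0Pn[w]; rewrite in_setI => /andP[].
  rewrite in_setU1 => /orP[/eqP->//|]; rewrite inE => iw.
  (* If the neighbour [w] is itself a target, its only neighbour is the vertex of [W] it hangs on,
     and that is [i]. *)
  rewrite mem_T => /orP[wW|/andP[wI /existsP[w' /andP[w'W ww']]]].
    by rewrite mem_T iI orbC; apply/orP; left; apply/existsP; exists w; rewrite wW.
  rewrite e_sym in iw; have := nbr_target leavesI wI iw.
  by rewrite (nbr_target leavesI wI ww') => /set1_inj <-; rewrite mem_T w'W.
- move=> i /setIP[iI]; rewrite mem_T.
  have iW : i \in W = false by apply: contraTF iI; apply: W_notin.
  rewrite iW iI /= => /existsP[w /andP[wW iw]]; apply/cards1P; exists w.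
  apply/setP => d; rewrite nbr_T_target // inE.
  apply/andP/eqP => [[_ id]|->//]; apply/set1_inj.
  by rewrite -(nbr_target leavesI iI id) (nbr_target leavesI iI iw).
Qed.

(** After substitution, [excess W] is exactly twice the right-hand side minus the left-hand side of
    the forked-tree inequality of [T]. Its constant 1 is the number of vertices minus the number of
    edges of [W]. *)
Lemma excess_forked : forked e I T g -> 0 <= excess W.
Proof.
move=> forkT; have subT : subtree e T g by split; [exact: T_tree | move=> u v /and3P[]].
have := x_forked subT forkT.
rewrite (forked_ineqE treeG leavesI (@upsum_mobius _ _ _ _ x) subT).
under eq_bigr do rewrite sum_many_card.
have -> : \sum_(c in T) (many c - \sum_(d in nbr g c) many_with c d)
    = \sum_(c in W) (many c - (\sum_(d in W | e c d) many_with c d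
                             + \sum_(i in I | e c i) many_with c i)).
  rewrite [LHS](big_setID W) /= (setIidPr (subsetUl _ _)) [X in _ + X]big1 ?addr0.
    apply: eq_bigr => c cW; congr (_ - _); rewrite nbr_T //.
    rewrite (eq_bigl (fun d => ((d \in W) || (d \in I)) && e c d)) => [|d]; last by rewrite !inE.
    rewrite (bigID (mem W)) /=; congr (_ + _); apply: eq_bigl => d.
      by case: (d \in W); rewrite ?andbF ?andbT.
    case: (boolP (d \in W)) => [/W_notin/negPf->|]; rewrite ?andbF ?andbT //.
  move=> c; rewrite in_setD mem_T => /andP[/negPf->] /= /andP[cI _].
  have lc := leavesI cI; rewrite many_leaf // big1 ?subr0 // => d _.
  exact: many_with_leaf.
have -> : \sum_(c in I) \sum_(d in nbr g c) (1 - coord_target x c d)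
    = \sum_(c in W) \sum_(i in I | e c i) (1 - arrow x i c).
  rewrite (exchange_big_dep (mem W)) /=; last by move=> i d iI; rewrite nbr_T_target // => /andP[].
  apply: eq_bigr => c cW; apply: eq_big => [i|i /andP[iI _]]; last by rewrite arrow_target.
  case: (boolP (i \in I)) => //= iI; by rewrite nbr_T_target // cW e_sym.
have treeW := induced_tree e_sym e_irr (@tree_acyclic _ _ treeG) rW W_conn.
have count := congr1 (fun n => n%:R : R) (tree_sum_deg treeW).
rewrite natrD natrM natr_sum /= in count.
set A := \sum_(c in W) \sum_(d in W | e c d) many_with c d.
have AC : \sum_(c in W) \sum_(d in W | e c d) many_with d c = A.
  rewrite (exchange_big_dep (mem W)) /= => [|c d _ /andP[]//].
  by apply: eq_bigr => d dW; apply: eq_bigl => c; rewrite dW e_sym.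
have EW : excess W = 2 * (\sum_(c in W) capacity c) - \sum_(c in W) (deg (induced e W) c)%:R
    + (A + \sum_(c in W) \sum_(d in W | e c d) many_with d c).
  rewrite /excess sumrB -mulr_sumr -addrA; congr (_ + _).
  rewrite /A -big_split /= -sumrN -sumrN -big_split; apply: eq_bigr => c cW /=.
  have -> : (deg (induced e W) c)%:R = \sum_(u in W | e c u) 1 :> R.
    rewrite /deg nbr_induced // -sum1_card natr_sum.
    by apply: eq_bigl => u; rewrite !inE andbC.
  rewrite -big_split -!sumrN -big_split; apply: eq_bigr => u /andP[uW cu] /=.
  rewrite /rest !arrow_nonleaf ?W_nonleaf // 1?e_sym //; ring.
have EC : \sum_(c in W) capacity c = #|W|%:R - \sum_(c in W) many c
    - \sum_(c in W) \sum_(i in I | e c i) (1 - arrow x i c)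
    + \sum_(c in W) \sum_(i in I | e c i) many_with c i.
  rewrite -sum1_card natr_sum -!sumrB -big_split; apply: eq_bigr => c cW /=.
  have -> : capacity c = 1 - many c - (\sum_(i in I | e c i) (1 - arrow x i c)
      - \sum_(i in I | e c i) many_with c i); last by ring.
  rewrite -sumrB /capacity; congr (_ - _); apply: eq_bigr => i /andP[iI ci].
  rewrite /rest (arrow_nonleaf (W_nonleaf cW)) //; ring.
rewrite EW EC AC sumrB big_split /= -/A; move: count; lra.
Qed.

(** As [u] has degree at most two, a parent set of two elements is all of [nbr e u] and contains the
    neighbour [w] in [T]. So [many u = many_with u w], and the difference is [arrow x w u]. *)
Lemma removable u : u \in W -> leaf g u -> (deg e u - deg g u < 2)%N ->
  0 <= capacity u - \sum_(v in W | e u v) rest u v.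
Proof.
move=> uW lu; rewrite (eqP lu) => du; have uI := W_notin uW.
have /cards1P[w Nw] := lu.
have wg : w \in nbr g u by rewrite Nw set11.
rewrite nbr_T // !inE in wg; case/andP: wg => wWI uw.
have -> : capacity u - \sum_(v in W | e u v) rest u v = 1 - many u - rest u w.
  rewrite /capacity -addrA -opprD; congr (_ - _).
  transitivity (\sum_(v in nbr g u) rest u v); last by rewrite Nw big_set1.
  rewrite nbr_T //.
  rewrite [RHS](eq_bigl (fun d => ((d \in W) || (d \in I)) && e u d)) => [|d]; last by rewrite !inE.
  rewrite [RHS](bigID (mem I)) /=; congr (_ + _); apply: eq_bigl => d.
    by case: (d \in I); rewrite ?andbF ?andbT ?orbT.
  case: (boolP (d \in I)) => dI; rewrite ?andbF ?andbT ?orbF //.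
  by apply: contraTF dI => /andP[/W_notin].
have -> : many u = many_with u w.
  apply: eq_bigl => S; case: (boolP (S \subset N u)) => //= SN.
  case: (boolP (2 <= #|S|)%N) => //= S2.
  have /eqP -> : S == N u.
    by rewrite eqEcard SN (leq_trans _ S2) // -/(deg e u); lia.
  by rewrite inE.
have wint : interior w by case/orP: wWI => [/W_nonleaf lw|wI]; rewrite /interior ?lw ?wI ?orbT.
have wu : e w u by rewrite e_sym.
have := arrow_ge0 wint wu; rewrite /rest (arrow_nonleaf (W_nonleaf uW) uw); lra.
Qed.

End Connected.

(** Induction on the size of [W]: a disconnected set splits, a leaf of [T] violating the degree
    condition is removed, and otherwise [T] is forked. *)
Lemma excess_ge0 W : (forall v, v \in W -> ~~ leaf e v) -> 0 <= excess W.
Proof.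
have [n] := ubnP #|W|; elim: n W => // n IH W; rewrite ltnS => cardW WV.
case: (set_0Vmem W) => [->|[r rW]]; first by rewrite /excess big_set0.
pose C := [set v in W | connect (induced e W) r v].
have CW : C \subset W by apply/subsetP => v; rewrite inE => /andP[].
have rC : r \in C by rewrite inE rW connect0.
case: (eqVneq C W) => [CE|neqCW]; last first.
  rewrite (@excess_split W C) //; last first.
    move=> v u; rewrite !inE => /andP[vW rv] uW vu; rewrite uW.
    by apply: connect_trans rv (connect1 _); rewrite /induced vW uW.
  have prC : (#|C| < #|W|)%N by rewrite proper_card // properEneq neqCW.
  have prD : (#|W :\: C| < #|W|)%N.
    rewrite proper_card //; apply/properP; split; first exact: subsetDl.
    by exists r; rewrite // inE rC.
  rewrite addr_ge0 // IH ?(leq_trans _ cardW) // => v.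
    by move/(subsetP CW)/WV.
  by rewrite inE => /andP[_ /WV].
have conW v : v \in W -> connect (induced e W) r v by rewrite -{1}CE inE => /andP[].
set T := W :|: [set i in I | [exists w in W, e i w]].
case: (pickP (fun u => [&& u \in W, leaf (induced e T) u
                         & (deg e u - deg (induced e T) u < 2)%N])) => [u /and3P[uW lu du]|good].
  rewrite (excess_remove uW) addr_ge0 //.
    apply: IH => [|v]; last by rewrite inE => /andP[_ /WV].
    by apply: leq_trans cardW; rewrite [leqRHS](cardsD1 u) uW.
  by rewrite mulr_ge0 // (removable WV rW uW lu du).
apply: (excess_forked WV rW conW); apply: T_forked => // u uW lu.
by have := good u; rewrite uW lu /= => /negbT; rewrite -leqNgt.
Qed.

(** The splitting theorem is applied to the edges between non-leaves, with [excess_ge0] as Hakimi's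
    condition. *)
Lemma nonleaf_split : exists t : 'I_p -> 'I_p -> R,
  (forall v u, ~~ leaf e v -> ~~ leaf e u -> e v u ->
     0 <= t v u /\ t v u + t u v = rest v u) /\
  (forall v, ~~ leaf e v ->
     \sum_(u | ~~ leaf e u && e v u) t v u <= capacity v).
Proof.
pose inn (z : 'I_p * 'I_p) := [&& ~~ leaf e z.1, ~~ leaf e z.2 & e z.1 z.2].
(* An edge occurs as two ordered pairs, each carrying half of its weight. *)
pose b z : R := if inn z then rest z.1 z.2 / 2 else 0.
pose m v : R := if leaf e v then 0 else capacity v.
have b0 z : 0 <= b z.
  rewrite /b; case: ifP => // /and3P[lv lu vu]; rewrite divr_ge0 //.
  by rewrite rest_ge0 // /interior ?lv ?lu.
have bvv v : b (v, v) = 0 by rewrite /b /inn /= e_irr !andbF.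
have slack0 W : 0 <= slack m b W.
  pose W' := [set v in W | ~~ leaf e v].
  suff -> : slack m b W = excess W' / 2.
    by rewrite divr_ge0 // excess_ge0 // => v; rewrite inE => /andP[].
  rewrite /slack /excess sumrB -mulr_sumr mulrBl mulrAC divff ?mul1r ?pnatr_eq0 //.
  congr (_ - _).
    rewrite [RHS](eq_bigl (fun v => (v \in W) && ~~ leaf e v)) => [|v]; last by rewrite inE.
    by rewrite [RHS]big_mkcondr; apply: eq_bigr => v _; rewrite /m; case: ifP.
  rewrite mulr_suml.
  under [RHS]eq_bigr do rewrite mulr_suml.
  rewrite pair_big_dep /= big_mkcond [RHS]big_mkcond; apply: eq_bigr => -[v u] _ /=.
  rewrite /b /inn /inside /= !inE.
  by case: (v \in W); case: (u \in W); case: (leaf e v); case: (leaf e u); case: (e v u).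
have [t [tb tm]] := fractional_split b0 bvv slack0.
(* The share of [v] collects its part as first end of one pair and as second end of the other. *)
exists (fun v u => t (v, u) + (b (u, v) - t (u, v))); split=> [v u lv lu vu|v lv].
  have := tb (v, u); have := tb (u, v); rewrite /b /inn /= lv lu vu e_sym vu (restC u v) /=.
  by move=> /andP[? ?] /andP[? ?]; split; lra.
apply: le_trans (_ : m v <= _); last by rewrite /m (negPf lv).
apply: le_trans (tm v).
have t0 z : ~~ inn z -> t z = 0.
  by move=> nz; apply/eqP; rewrite eq_le andbC; have := tb z; rewrite /b (negPf nz).
have -> : \sum_(z : 'I_p * 'I_p | z.1 == v) t z = \sum_u t (v, u).
  transitivity (\sum_(w | w == v) \sum_u t (w, u)); last by rewrite big_pred1_eq.
  by rewrite pair_big /=; apply: eq_big => [[w u]|[w u]] //=; rewrite andbT.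
have -> : \sum_(z : 'I_p * 'I_p | z.2 == v) (b z - t z) = \sum_u (b (u, v) - t (u, v)).
  transitivity (\sum_u \sum_(w | w == v) (b (u, w) - t (u, w))).
    by rewrite pair_big /=; apply: eq_big => [[w u]|[w u]].
  by apply: eq_bigr => u _; rewrite big_pred1_eq.
rewrite -big_split [leRHS](bigID (fun u => ~~ leaf e u && e v u)) /=.
rewrite [X in _ <= _ + X]big1 ?addr0 // => u nu.
have n1 : ~~ inn (v, u) by apply: contra nu => /and3P[_ -> ->].
have n2 : ~~ inn (u, v) by apply: contra nu => /and3P[/= -> _]; rewrite e_sym.
by rewrite !t0 // /b (negPf n2) subr0 addr0.
Qed.

(** * Edges joining two leaves *)

Lemma adjacent_leaves_setT u v : e u v -> leaf e u -> leaf e v ->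
  [set: 'I_p] = [set u; v].
Proof.
move=> uv lu lv; apply/setP => w.
by rewrite !inE (adjacent_leaves treeG uv lu lv).
Qed.

(** This excludes the single edge with one target: its other end is a leaf of [graphI], so neither a
    bidirected-edge nor a forked-tree inequality exists to bound the one coordinate from above. *)
Lemma adjacent_leaves_target u v : e u v -> leaf e u -> leaf e v -> u \in I -> v \in I.
Proof.
move=> uv lu lv uI; apply/negPn/negP => vI; apply: nondegenerate.
have neq_uv : u != v by apply: contraTneq uv => ->; rewrite e_irr.
have V2 := adjacent_leaves_setT uv lu lv.
split; first by rewrite -[p]card_ord -cardsT V2 cards2 neq_uv.
suff -> : I = [set u] by rewrite cards1.
apply/setP => w; rewrite inE; have /orP[/eqP->|/eqP->] := adjacent_leaves treeG uv lu lv w.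
  by rewrite uI eqxx.
by rewrite (negPf vI) eq_sym (negPf neq_uv).
Qed.

(** The bidirected-edge inequality gives one bound, and the forked-tree inequality of the whole
    graph, a single edge, gives the other. *)
Lemma adjacent_targets u v : e u v -> u \in I -> v \in I ->
  arrow x u v + arrow x v u = 1.
Proof.
move=> uv uI vI; have [lu lv] := (leavesI uI, leavesI vI).
have neq_uv : u != v by apply: contraTneq uv => ->; rewrite e_irr.
have vu : e v u by rewrite e_sym.
have V2 := adjacent_leaves_setT uv lu lv.
have allI w : w \in I.
  by have /orP[/eqP->|/eqP->] := adjacent_leaves treeG uv lu lv w.
apply/eqP; rewrite eq_le; apply/andP; split.
  have := rest_ge0 _ _ uv; rewrite /interior uI vI !orbT => /(_ isT isT).
  by rewrite /rest; lra.
have forkT : forked e I [set: 'I_p] e.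
  split=> [w _|w _ _|//|w _]; first by rewrite -interiorE /interior allI orbT.
    by rewrite allI.
  exact/leavesI/allI.
have subT : subtree e [set: 'I_p] e by split.
have := x_forked subT forkT.
rewrite (forked_ineqE treeG leavesI (@upsum_mobius _ _ _ _ x) subT).
rewrite big1 ?add0r => [|c _]; last first.
  apply: big_pred0 => S; apply/negP => /andP[/(leaf_small (leavesI (allI c)))].
  by rewrite ltnNge => /negPf->.
rewrite (eq_bigl (mem [set u; v])) => [|w]; last by rewrite /= -V2 inE allI.
rewrite big_setU1 ?inE //= big_set1.
rewrite (nbr_target leavesI uI uv) (nbr_target leavesI vI vu) !big_set1 !arrow_target //.
lra.
Qed.

(* [tau v u] is the probability that u is the only parent of v *)
Lemma single_parent : exists tau : 'I_p -> 'I_p -> R,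
  [/\ forall v u, e v u -> 0 <= tau v u,
      forall v, many v + \sum_(u in N v) tau v u <= 1,
      forall v u, e v u -> many_with v u + tau v u + (many_with u v + tau u v) = 1
    & forall i u, i \in I -> e i u -> tau i u = coord_target x i u].
Proof.
have [t [tP tcap]] := nonleaf_split.
(* Target coordinates are prescribed and [rest] goes to the other end. A leaf that is no target
   takes all that its non-leaf neighbour leaves. If both ends are leaves and no targets, the order
   of the labels picks an arbitrary direction. *)
pose tau v u : R :=
  if leaf e v then
    if v \in I then arrow x v u
    else if leaf e u then (u < v)%N%:R else 1 - many_with u v
  else if leaf e u then (if u \in I then rest v u else 0) else t v u.
have tau0 v u : e v u -> 0 <= tau v u.
  move=> vu; have uv : e u v by rewrite e_sym.
  rewrite /tau; case: (boolP (leaf e v)) => lv; case: (boolP (leaf e u)) => lu.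
  - by case: ifP => // vI; rewrite arrow_ge0 // /interior vI orbT.
  - case: ifP => vI; first by rewrite arrow_ge0 // /interior vI orbT.
    rewrite subr_ge0; apply: le_trans (many_with_le _ _) _.
    (* The capacity bounds a sum of nonnegative shares; its nonnegativity yields [many u <= 1]. *)
    have cap0 : 0 <= capacity u.
      apply: le_trans (tcap u lu); apply: sumr_ge0 => w /andP[lw uw].
      by case: (tP u w lu lw uw).
    move: cap0; rewrite /capacity.
    have : 0 <= \sum_(i in I | e u i) rest u i.
      apply: sumr_ge0 => i /andP[iI ui]; apply: rest_ge0 => //.
        by rewrite /interior lu.
      by rewrite /interior iI orbT.
    by lra.
  - by case: ifP => // uI; rewrite rest_ge0 // /interior ?lv ?uI ?orbT.
  - by case: (tP v u lv lu vu).
have tau1 v u : e v u -> many_with v u + tau v u + (many_with u v + tau u v) = 1.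
  move=> vu; have uv : e u v by rewrite e_sym.
  rewrite /tau; case: (boolP (leaf e v)) => lv; case: (boolP (leaf e u)) => lu.
  - rewrite !many_with_leaf // !add0r.
    case: (boolP (v \in I)) => vI.
      have uI := adjacent_leaves_target vu lv lu vI.
      by rewrite uI adjacent_targets.
    have /negPf-> : u \notin I by apply: contra vI; apply: adjacent_leaves_target.
    have neq : (u : nat) != v by apply: contraTneq vu => /val_inj ->; rewrite e_irr.
    by case: ltngtP neq => // _ _; rewrite ?addr0 ?add0r.
  - rewrite many_with_leaf //; case: ifP => vI; last by ring.
    by rewrite /rest (arrow_nonleaf lu uv); ring.
  - rewrite (many_with_leaf _ lu) //; case: ifP => uI; last by ring.
    by rewrite /rest (arrow_nonleaf lv vu); ring.
  - have [_ E] := tP v u lv lu vu; move: E.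
    by rewrite /rest (arrow_nonleaf lu uv) (arrow_nonleaf lv vu); lra.
exists tau; split=> // [v|i u iI iu]; last by rewrite /tau (leavesI iI) iI arrow_target.
(* At a leaf the bound follows from the equation of its only edge, at other vertices from the
   capacity. *)
case: (boolP (leaf e v)) => lv.
  have /cards1P[u Nv] := lv; have vu : e v u by have := set11 u; rewrite -Nv inE.
  have := tau1 v u vu; have := tau0 u v; rewrite e_sym => /(_ vu).
  have := many_with_ge0 u v; rewrite many_leaf // (many_with_leaf _ lv) Nv big_set1.
  by lra.
have := tcap v lv; rewrite /capacity.
suff -> : \sum_(u in N v) tau v u
    = \sum_(i in I | e v i) rest v i + \sum_(u | ~~ leaf e u && e v u) t v u by lra.
rewrite (bigID (leaf e)) /= addrC [RHS]addrC /tau (negPf lv); congr (_ + _).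
  apply: eq_big => [u|u /andP[_ /negPf->]//]; by rewrite inE andbC.
rewrite (eq_bigl (fun u => leaf e u && e v u)) => [|u]; last by rewrite inE andbC.
rewrite (bigID (mem I)) /= [X in _ + X]big1 ?addr0; last first.
  by move=> u /andP[/andP[-> _] /negPf->].
apply: eq_big => [u|u /andP[/andP[-> _] ->]//].
by case: (boolP (u \in I)) => uI; rewrite ?andbF ?andbT //= leavesI.
Qed.

(** Parent sets with at least two elements receive their Möbius value, singletons receive [tau], and
    the empty set receives the remaining mass [none]. *)
Lemma ineqs_local_marginals : exists q, local_marginals x q.
Proof.
have [tau [tau0 tau_le tau1 tauI]] := single_parent.
pose none v : R := 1 - many v - \sum_(u in N v) tau v u.
pose q v S : R := mobius x v S *+ ((S \subset N v) && (2 <= #|S|)%N)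
  + none v *+ (S == set0) + \sum_(u in N v) tau v u *+ (S == [set u]).
have q_sum v (Phi : pred {set 'I_p}) : \sum_(S | Phi S) q v S =
    \sum_(S : {set 'I_p} | (S \subset N v) && ((2 <= #|S|)%N && Phi S)) mobius x v S
    + none v *+ Phi set0 + \sum_(u in N v) tau v u *+ Phi [set u].
  rewrite /q !big_split /=; congr (_ + _ + _).
  - rewrite big_mkcond [RHS]big_mkcond; apply: eq_bigr => S _.
    by case: (S \subset N v); case: (2 <= #|S|)%N; case: (Phi S).
  - rewrite big_mkcond (bigD1 set0) //= eqxx big1 ?addr0; first by case: (Phi _).
    by move=> S /negPf->; case: (Phi S).
  - rewrite exchange_big /=; apply: eq_bigr => u _.
    rewrite big_mkcond (bigD1 [set u]) //= eqxx big1 ?addr0; first by case: (Phi _).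
    by move=> S /negPf->; case: (Phi S).
have q_in v u : e v u -> \sum_(S : {set 'I_p} | u \in S) q v S = many_with v u + tau v u.
  move=> vu; rewrite q_sum inE mulr0n addr0; congr (_ + _).
  rewrite (bigD1 u) ?inE //= eqxx big1 ?addr0 // => w /andP[_ /negPf wu].
  by rewrite inE eq_sym wu.
exists q; split.
- move=> v S; apply: addr_ge0; first apply: addr_ge0.
  + case: (boolP (_ && _)) => [/andP[SN S2]|_]; last by rewrite mulr0n.
    by rewrite mulrn_wge0 // mobius_ge0.
  + by rewrite mulrn_wge0 // /none; have := tau_le v; lra.
  + by apply: sumr_ge0 => u; rewrite inE => vu; rewrite mulrn_wge0 // tau0.
- move=> v; rewrite (q_sum v xpredT) mulr1n /none.
  under eq_bigl do rewrite andbT.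
  under [X in _ + X]eq_bigr do rewrite mulr1n.
  rewrite -/(many v); ring.
- move=> v S; apply: contraNT => NS; rewrite /q (negPf NS) mulr0n add0r.
  have /negPf-> : S != set0 by apply: contraNneq NS => ->; rewrite sub0set.
  rewrite mulr0n add0r big1 // => u uN.
  by have /negPf-> : S != [set u] by apply: contraNneq NS => ->; rewrite sub1set.
- by move=> u v uv; have vu : e v u; rewrite 1?e_sym // !q_in // tau1.
- move=> v B BN B2; rewrite (upsum_mobius _ BN B2); apply: eq_bigr => S /andP[SN BS].
  have S2 := leq_trans B2 (subset_leq_card BS).
  rewrite /q SN S2 mulr1n.
  have /negPf-> : S != set0 by apply: contraTneq S2 => ->; rewrite cards0.
  rewrite mulr0n addr0 big1 ?addr0 // => u _.
  by have /negPf-> : S != [set u] by apply: contraTneq S2 => ->; rewrite cards1.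
- by move=> i u iI iu; rewrite q_in // tauI // many_with_leaf ?add0r // leavesI.
Qed.

End Sufficiency.

Theorem theorem1p2 (R : realType) (p : nat) (e : rel 'I_p) (I : {set 'I_p})
    (treeG : tree [set: 'I_p] e)
    (leavesI : forall i : 'I_p, i \in I -> leaf e i)
    (nondegenerate : ~ (p = 2 /\ #|I| = 1)) :
  forall x : cim_space R e I,
    CIM x <-> [/\ star_ineqs x, bidirected_ineqs x & forked_tree_ineqs x].
Proof.
move=> x; split=> [/(CIM_local_marginals treeG leavesI)[q xq]|[xs xb xf]].
  split; [exact: marg_star_ineqs xq | exact: marg_bidirected xq |].
  exact: marg_forked xq.
have [q xq] := ineqs_local_marginals treeG leavesI nondegenerate xs xb xf.
exact: local_marginals_CIM xq.
Qed.
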